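(* Let $E_1=(1,1,1,\dots)\in\{0,1\}^{\mathbb{N}}$. Then \[\Phi(E_1)=\hat{\Phi}(E_1)=\Phi^*(E_1)=\operatorname{clos}(\mathbb{D})\cup\bigl(-\mathcal{G}_{[0,1]}^{-1}\bigr).\]
   Context: $\mathbb{N}$ is the set of non-negative integers. Throughout, $\beta>1$ is a non-integer real number. For $y\in\mathbb{R}$, $[y]$ and $\{y\}$ denote the integer and fractional parts. $\mathbb{D}$ is the open unit disk in $\mathbb{C}$; $\operatorname{clos}(A)$ is the closure of $A\subset\mathbb{C}$ in $\mathbb{C}$; $A^{-1}=\{z^{-1}: z\in A\}$ and $-A=\{-z: z\in A\}$ (so $-\mathcal{G}^{-1}$ is the set of all $-z^{-1}$, $z\in\mathcal{G}$). Generalized beta-maps: for $E=(E(0),E(1),\dots)\in\{0,1\}^{\mathbb{N}}$, let $T_\beta(x)=\{\beta x\}$, $I_\beta(x)=[\beta x]$ and \[\tau_{\beta,E}:[0,1]\to[0,1],\qquad \tau_{\beta,E}(x)=E(I_\beta(x))+(-1)^{E(I_\beta(x))}T_\beta(x).\] For $E=E_1$ this is the negative $\beta$-transformation $x\mapsto 1-\{\beta x\}$. For $x\in[0,1]$ and $n\ge 0$ put \[d_n(\beta,E,x)=E(I_\beta(\tau_{\beta,E}^n(x)))+I_\beta(\tau_{\beta,E}^n(x)),\quad e_n(\beta,E,x)=(-1)^{E(I_\beta(\tau_{\beta,E}^n(x)))},\] $s_0(\beta,E,x)=1$ and $s_n(\beta,E,x)=\prod_{i=0}^{n-1}e_i(\beta,E,x)$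 for $n\ge1$. Let $EP=\{1/\beta,2/\beta,\dots,[\beta]/\beta\}$. $\beta$ is a generalized Parry number with respect to $E$ if the orbit $\{\tau_{\beta,E}^n(1): n\ge 0\}$ is a finite set (for $E=E_1$ such $\beta$ are called Yrrap numbers); $\beta$ is simple with respect to $E$ if $\tau_{\beta,E}^n(1)\in EP$ for some $n\ge1$ (a simple $\beta$ is a generalized Parry number). Generalized Parry numbers are algebraic integers. A Galois conjugate of $\beta$ means a root in $\mathbb{C}$, different from $\beta$ itself, of the minimal polynomial of $\beta$ over $\mathbb{Q}$. $\Phi(E)$ is the closure of the set of all Galois conjugates of all simple generalized Parry numbers with respect to $E$; $\hat\Phi(E)$ is the closure of the set of all Galois conjugates of all generalized Parry numbers with respect to $E$. Define $\phi_{\tau_{\beta,E}}$ as follows. If $\beta$ is simple with respect to $E$, let $N=\min\{n\ge1:\tau_{\beta,E}^n(1)\in EP\}$, $k_0=\beta\tau_{\beta,E}^N(1)$ and \[\phi_{\tau_{\beta,E}}(z)=\sum_{n=0}^{N-1}s_n(\beta,E,1)d_n(\beta,E,1)z^{n+1}+k_0s_N(\beta,E,1)z^{N+1};\] otherwise \[\phi_{\tau_{\beta,E}}(z)=\sum_{n=0}^{\infty}s_n(\beta,E,1)d_n(\beta,E,1)z^{n+1}.\] This is a polynomial if $\beta$ is simple; it extends to a rational function on $\mathbb{C}$ if $\beta$ is a non-simple generalized Parry number; otherwise it is a power series considered on $\mathbb{D}$. One has $1-\phi_{\tau_{\beta,E}}(\beta^{-1})=0$. Set \[\Phi^*(E)=\operatorname{clos}\bigl(\{z^{-1}\in\mathbb{C}: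 \exists\,\beta>1 \text{ with } 1-\phi_{\tau_{\beta,E}}(z)=0,\ z\neq\beta^{-1}\}\bigr),\] where $z$ ranges over the domain of $\phi_{\tau_{\beta,E}}$ just described. For a bounded interval $I\subset\mathbb{R}$, let \[\mathcal{F}_I=\Bigl\{1+\sum_{n=1}^\infty a_nz^n: a_i\in I\text{ for } i\ge1\Bigr\},\qquad \mathcal{G}_I=\{z\in\mathbb{D}: \exists f\in\mathcal{F}_I \text{ with } f(z)=0\}.\] *)

(* Defs.v *)
From HB Require Import structures.
From mathcomp Require Import all_boot all_order all_algebra.
From mathcomp Require Import all_classical all_reals all_analysis.
From mathcomp Require Import complex.

Set Implicit Arguments.
Unset Strict Implicit.
Unset Printing Implicit Defensive.

Import Order.TTheory GRing.Theory Num.Theory.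
Import numFieldNormedType.Exports.

Local Open Scope classical_set_scope.
Local Open Scope ring_scope.
Local Open Scope complex_scope.

(* The usual topology of the complex plane: R[i] is a normed space over itself
   for its norm `|z|.  This norm takes values in R[i]; since 0 <= `|z|, an
   inequality `|z| < 1 in R[i] is the inequality between real numbers. *)
#[warnings="-redundant-canonical-projection"]
HB.instance Definition _ (R : rcfType) := NormedModule.copy R[i] R[i]^o.

Section GeneralizedBetaMaps.
Variable R : realType.
Implicit Types (beta x : R) (E : nat -> bool) (z w : R[i]).

Definition base beta : Prop := 1 < beta /\ beta \isn't a Num.int.

(* Num.truncn is the floor on nonnegative numbers, the only ones to which it
   is applied here since x ranges over [0, 1]. *)
Definition Ibeta beta x : nat := Num.truncn (beta * x).

Definition Tbeta beta x : R := beta * x - (Ibeta beta x)%:R.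

Definition tau beta E x : R :=
  (E (Ibeta beta x))%:R + (-1) ^+ E (Ibeta beta x) * Tbeta beta x.

Definition tau_iter beta E x (n : nat) : R := iter n (tau beta E) x.

Definition d_ beta E x (n : nat) : R :=
  (E (Ibeta beta (tau_iter beta E x n)))%:R + (Ibeta beta (tau_iter beta E x n))%:R.

Definition e_ beta E x (n : nat) : R := (-1) ^+ E (Ibeta beta (tau_iter beta E x n)).

Definition s_ beta E x (n : nat) : R := \prod_(i < n) e_ beta E x i.

Definition EP beta : set R :=
  [set x | exists k : nat, (1 <= k <= Num.truncn beta)%N /\ x = k%:R / beta].

Definition gen_parry beta E : Prop := finite_set (range (tau_iter beta E 1)).

Definition is_simple beta E : Prop :=
  exists n : nat, (1 <= n)%N /\ EP beta (tau_iter beta E 1 n).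

Definition first_EP_time beta E (N : nat) : Prop :=
  [/\ (1 <= N)%N, EP beta (tau_iter beta E 1 N) &
      forall m : nat, (1 <= m < N)%N -> ~ EP beta (tau_iter beta E 1 m)].

Definition is_minpoly beta (p : {poly rat}) : Prop :=
  [/\ p \is monic, root (map_poly (ratr : rat -> R) p) beta &
      forall q : {poly rat}, q != 0 -> root (map_poly (ratr : rat -> R) q) beta ->
        (size p <= size q)%N].

Definition galois_conjugate beta z : Prop :=
  exists p : {poly rat},
    [/\ is_minpoly beta p, root (map_poly (ratr : rat -> R[i]) p) z &
        z != beta%:C].

Definition Phi E : set R[i] :=
  closure [set z | exists beta,
    [/\ base beta, is_simple beta E & galois_conjugate beta z]].

Definition Phi_hat E : set R[i] :=
  closure [set z | exists beta,
    [/\ base beta, gen_parry beta E & galois_conjugate beta z]].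

Definition phi_term beta E z (n : nat) : R[i] :=
  (s_ beta E 1 n * d_ beta E 1 n)%:C * z ^+ n.+1.

(* phi_at beta E z w: the point z is in the domain of phi_{tau_{beta,E}} and
   w is the value there.  The domain is the whole plane if beta is simple, the
   plane without the poles of the rational extension if beta is a non-simple
   generalized Parry number, and the open unit disk otherwise.  In the second
   case P / Q need not be in lowest terms: the value does not depend on the
   fraction, and z is a pole when no fraction has Q.[z] != 0. *)
Definition phi_at beta E z w : Prop :=
  [\/ exists2 N : nat, first_EP_time beta E N &
        w = \sum_(0 <= n < N) phi_term beta E z n
            + (beta * tau_iter beta E 1 N * s_ beta E 1 N)%:C * z ^+ N.+1,
      [/\ ~ is_simple beta E, gen_parry beta E &
        exists P Q : {poly R[i]},
          [/\ forall u : R[i], `|u| < 1 -> Q.[u] != 0 ->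
                series (phi_term beta E u) @ \oo --> P.[u] / Q.[u],
              Q.[z] != 0 & w = P.[z] / Q.[z]]] |
      [/\ ~ is_simple beta E, ~ gen_parry beta E, `|z| < 1 &
        series (phi_term beta E z) @ \oo --> w]].

(* As phi(0) = 0, the points z below are nonzero, so that the convention
   0^-1 = 0 plays no role. *)
Definition Phi_star E : set R[i] :=
  closure [set z^-1 | z in [set z | exists beta,
    [/\ base beta, exists2 w, phi_at beta E z w & 1 - w = 0 &
        z != (beta^-1)%:C]]].

Definition unit_disk : set R[i] := [set z | `|z| < 1].

(* Only the values of f on the open unit disk are specified. *)
Definition calF (I : interval R) : set (R[i] -> R[i]) :=
  [set f | exists2 a : nat -> R, (forall i, (1 <= i)%N -> a i \in I) &
    forall z, `|z| < 1 ->
      (fun n : nat => 1 + \sum_(1 <= k < n) (a k)%:C * z ^+ k) @ \oo --> f z].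

(* Every f in calF I satisfies f 0 = 1, hence 0 is not in calG I. *)
Definition calG (I : interval R) : set R[i] :=
  [set z | unit_disk z /\ exists2 f, calF I f & f z = 0].

End GeneralizedBetaMaps.

Definition E1 : nat -> bool := fun=> true.

(* Main.v *)
(**
  Write x_n = tau^n(1), so that x_(n+1) = d_n - beta x_n, and put w = - z.  Then
  1 - phi(z) = (1 + beta w) \sum x_n w^n with x_0 = 1 and 0 <= x_n <= 1.  Hence
  the zeros z <> 1 / beta of 1 - phi in the disk are opposite to elements of
  calG, and calG is relatively closed in the disk because [0, 1]^N is compact.
  For a Galois conjugate z of a generalized Parry number, replace x_n = D_n(beta),
  D_n with integer coefficients, by D_n(z): these take finitely many values, and
  with w = - 1 / z the partial sums telescope to D_n(z) w^n, which tends to 0.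

  Conversely let y satisfy y^N + b_(N-1) y^(N-1) + ... + b_0 = 0 with all b_i in
  [0, 1].  Large digits c_i in 2 + 4 Z with c_i / c_N close to b_i are the
  digits of a simple beta close to c_N: solve x_n = (c_(N-n) - x_(n+1)) / beta
  backwards from x_(N+1) = 0 and get x_0 = 1 from the intermediate value
  theorem.  The polynomial of beta so obtained is an Eisenstein polynomial at 2,
  so that all its roots are conjugates, and one of them is close to - y.
  Such equations hold at every nonreal y in the disk and, up to a small dilation
  of w, at y = 1 / w for w in calG: if w is not a nonnegative real, a polynomial
  with nonnegative coefficients vanishes at w, and adding a multiple of it makes
  any small correction have coefficients in [0, d].
*)
Require Import Defs.
From mathcomp Require Import all_boot all_order all_algebra.
From mathcomp Require Import all_classical all_reals all_analysis.
From mathcomp Require Import complex.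
From mathcomp Require Import zify ring lra.
Set Implicit Arguments.
Unset Strict Implicit.
Unset Printing Implicit Defensive.
Import Order.TTheory GRing.Theory Num.Theory.
Import numFieldNormedType.Exports.
Local Open Scope classical_set_scope.
Local Open Scope ring_scope.
Local Open Scope complex_scope.

(** * The modulus of a complex number as a real number *)

(** The norm of [R[i]] takes values in [R[i]]; its real part lies in [R], where the order is
    total. *)
Definition cabs (R : rcfType) (z : R[i]) : R := complex.Re `|z|.

Lemma cabsE (R : rcfType) (z : R[i]) : (cabs z)%:C = `|z|.
Proof. by rewrite RRe_real // normr_real. Qed.

Lemma cabs_lt (R : rcfType) (z : R[i]) (e : R) : (`|z| < e%:C) = (cabs z < e).
Proof. by rewrite -cabsE ltcR. Qed.

Lemma cabs_lt1 (R : rcfType) (z : R[i]) : (`|z| < 1) = (cabs z < 1).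
Proof. exact: (cabs_lt z 1). Qed.

Lemma cabs_ge0 (R : rcfType) (z : R[i]) : 0 <= cabs z.
Proof. by rewrite -lecR cabsE normr_ge0. Qed.

Lemma cabs0 (R : rcfType) : cabs (0 : R[i]) = 0.
Proof. by apply: complexI; rewrite cabsE normr0. Qed.

Lemma cabs1 (R : rcfType) : cabs (1 : R[i]) = 1.
Proof. by apply: complexI; rewrite cabsE normr1. Qed.

Lemma cabs_eq0 (R : rcfType) (z : R[i]) : (cabs z == 0) = (z == 0).
Proof. by rewrite -(inj_eq (@complexI R)) cabsE normr_eq0. Qed.

Lemma cabs_gt0 (R : rcfType) (z : R[i]) : (0 < cabs z) = (z != 0).
Proof. by rewrite lt0r cabs_ge0 cabs_eq0 andbT. Qed.

Lemma cabsM (R : rcfType) (x y : R[i]) : cabs (x * y) = cabs x * cabs y.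
Proof. by apply: complexI; rewrite rmorphM /= !cabsE normrM. Qed.

Lemma cabsX (R : rcfType) (x : R[i]) n : cabs (x ^+ n) = cabs x ^+ n.
Proof. by apply: complexI; rewrite rmorphXn /= !cabsE normrX. Qed.

Lemma cabsV (R : rcfType) (x : R[i]) : cabs x^-1 = (cabs x)^-1.
Proof. by apply: complexI; rewrite fmorphV /= !cabsE normfV. Qed.

Lemma cabsN (R : rcfType) (x : R[i]) : cabs (- x) = cabs x.
Proof. by apply: complexI; rewrite !cabsE normrN. Qed.

Lemma cabsB (R : rcfType) (x y : R[i]) : cabs (x - y) = cabs (y - x).
Proof. by apply: complexI; rewrite !cabsE distrC. Qed.

Lemma cabsD (R : rcfType) (x y : R[i]) : cabs (x + y) <= cabs x + cabs y.
Proof. by rewrite -lecR rmorphD /= !cabsE ler_normD. Qed.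

Lemma cabs_real (R : rcfType) (x : R) : cabs x%:C = `|x|.
Proof.
apply: complexI; rewrite cabsE normc_def /= expr0n addr0.
by rewrite -real_normK ?num_real // sqrtr_sqr normr_id.
Qed.

Lemma cabs_sum (R : rcfType) (I : Type) (r : seq I) (P : pred I)
    (F : I -> R[i]) :
  cabs (\sum_(i <- r | P i) F i) <= \sum_(i <- r | P i) cabs (F i).
Proof.
elim/big_ind2 : _ => [|x1 x2 y1 y2 h1 h2|//]; first by rewrite cabs0.
exact: le_trans (cabsD _ _) (lerD _ _).
Qed.

Lemma Re_le_cabs (R : rcfType) (z : R[i]) : `|complex.Re z| <= cabs z.
Proof. by rewrite -lecR cabsE normc_ge_Re. Qed.

Lemma Im_le_cabs (R : rcfType) (z : R[i]) : `|complex.Im z| <= cabs z.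
Proof.
have h : cabs ('i%C * z) = cabs z.
  rewrite cabsM; suff -> : cabs ('i%C : R[i]) = 1 by rewrite mul1r.
  by apply: complexI; rewrite cabsE normc_def /= expr0n expr1n add0r sqrtr1.
by rewrite -h; apply: le_trans (Re_le_cabs _); rewrite mulrC ReiNIm normrN.
Qed.

Lemma cabs_le_ReIm (R : rcfType) (z : R[i]) :
  cabs z <= `|complex.Re z| + `|complex.Im z|.
Proof.
rewrite {1}[z]complexE (le_trans (cabsD _ _)) // cabsM !cabs_real.
suff -> : cabs ('i%C : R[i]) = 1 by rewrite mul1r.
by apply: complexI; rewrite cabsE normc_def /= expr0n expr1n add0r sqrtr1.
Qed.

(** * Convergence and closure in the complex plane *)

Lemma complex_cvgP (R : realType) (u : nat -> R[i]) (l : R[i]) :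
  (u @ \oo --> l) <->
  (forall e : R, 0 < e -> exists N, forall n, (N <= n)%N -> cabs (u n - l) < e).
Proof.
split=> [/cvgrPdistC_lt ul e e0|h].
  have [|N _ hN] := ul e%:C; first by rewrite (ltcR 0).
  by exists N => n Nn; rewrite -cabs_lt hN.
apply/cvgrPdistC_lt => e e0.
have [k ek] := complex_realP _ (gtr0_real e0).
move: e0; rewrite ek (ltcR 0) => k0; have [N hN] := h _ k0.
by exists N => // n /= Nn; rewrite cabs_lt hN.
Qed.

Lemma complex_closureP (R : realType) (A : set R[i]) (z : R[i]) :
  closure A z <-> (forall e : R, 0 < e -> exists2 a, A a & cabs (z - a) < e).
Proof.
split=> [cA e e0|h B].
  have [|a [Aa Ba]] := cA [set a | `|z - a| < e%:C].
    by apply/nbhs_ballP; exists e%:C => /=; [rewrite (ltcR 0)|rewrite -ball_normE].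
  by exists a => //; rewrite -cabs_lt.
move=> /nbhs_ballP [e /= e0 eB].
have [k ek] := complex_realP _ (gtr0_real e0).
move: (e0); rewrite ek (ltcR 0) => k0; have [a Aa ha] := h _ k0.
by exists a; split=> //; apply: eB; rewrite -ball_normE /= ek cabs_lt.
Qed.

Lemma expr_small (R : realType) (r e : R) : 0 <= r -> r < 1 -> 0 < e ->
  exists N, forall n, (N <= n)%N -> r ^+ n < e.
Proof.
move=> r0 r1 e0.
have : r ^+ n @[n --> \oo] --> (0 : R) by apply: cvg_expr; rewrite ger0_norm.
move=> /cvgrPdistC_lt /(_ _ e0) [N _ hN]; exists N => n Nn.
by have := hN _ Nn; rewrite /= subr0 ger0_norm // exprn_ge0.
Qed.

(** * Power series with bounded coefficients *)

Definition psum (R : rcfType) (a : nat -> R) (z : R[i]) n : R[i] :=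
  \sum_(0 <= k < n) (a k)%:C * z ^+ k.

Lemma psumS (R : rcfType) (a : nat -> R) (z : R[i]) n :
  psum a z n.+1 = psum a z n + (a n)%:C * z ^+ n.
Proof. by rewrite /psum big_nat_recr. Qed.

Lemma cabs_psumB (R : rcfType) (a : nat -> R) (z : R[i]) m n :
  (forall k, `|a k| <= 1) -> cabs z < 1 ->
  cabs (psum a z (n + m) - psum a z n) <= cabs z ^+ n / (1 - cabs z).
Proof.
move=> a1 z1; have h : 0 < 1 - cabs z by rewrite subr_gt0.
(* The exact geometric sum, stronger than the claim, is what the induction on [m] preserves. *)
suff : cabs (psum a z (n + m) - psum a z n)
    <= (cabs z ^+ n - cabs z ^+ (n + m)) / (1 - cabs z).
  move/le_trans; apply; rewrite ler_pM2r ?invr_gt0 //.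
  by rewrite lerBlDr lerDl exprn_ge0 // cabs_ge0.
elim: m => [|m IH]; first by rewrite addn0 !subrr cabs0 mul0r.
rewrite addnS psumS addrAC (le_trans (cabsD _ _)) //.
apply: le_trans (lerD IH (_ : _ <= cabs z ^+ (n + m))) _.
  rewrite cabsM cabs_real cabsX ler_piMl ?exprn_ge0 ?cabs_ge0 //.
rewrite -{2}[cabs z ^+ (n + m)](mulfK (lt0r_neq0 h)) -mulrDl exprSr.
by rewrite le_eqVlt; apply/orP; left; apply/eqP; congr (_ / _); ring.
Qed.

Lemma ReD (R : rcfType) : {morph (@complex.Re R) : x y / x + y}.
Proof. by case=> ? ? []. Qed.

Lemma ImD (R : rcfType) : {morph (@complex.Im R) : x y / x + y}.
Proof. by case=> ? ? []. Qed.

Lemma Re_sum (R : rcfType) (I : Type) (r : seq I) (P : pred I)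
    (F : I -> R[i]) :
  complex.Re (\sum_(i <- r | P i) F i) = \sum_(i <- r | P i) complex.Re (F i).
Proof. by elim/big_rec2 : _ => // i x y _ <-; rewrite ReD. Qed.

Lemma Im_sum (R : rcfType) (I : Type) (r : seq I) (P : pred I)
    (F : I -> R[i]) :
  complex.Im (\sum_(i <- r | P i) F i) = \sum_(i <- r | P i) complex.Im (F i).
Proof. by elim/big_rec2 : _ => // i x y _ <-; rewrite ImD. Qed.

Lemma series_dominated_cvg (R : realType) (r : R) (v : nat -> R) :
  0 <= r < 1 -> (forall n, `|v n| <= r ^+ n) -> cvgn (series v).
Proof.
move=> /andP[r0 r1] h; apply: normed_cvg.
apply: (series_le_cvg (v_ := geometric 1 r)).
- by move=> n /=; exact: normr_ge0.
- by move=> n; rewrite /geometric /= mul1r exprn_ge0.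
- by move=> n; rewrite /geometric /= mul1r.
- by apply: is_cvg_geometric_series; rewrite ger0_norm.
Qed.

(** Real and imaginary parts converge by comparison with a geometric series; the rate at [n] is read
    off a partial sum far beyond [n]. *)
Lemma psum_cvg (R : realType) (a : nat -> R) (z : R[i]) :
  (forall k, `|a k| <= 1) -> cabs z < 1 ->
  exists l, forall n, cabs (psum a z n - l) <= cabs z ^+ n / (1 - cabs z).
Proof.
move=> a1 z1.
have t1 k : cabs ((a k)%:C * z ^+ k) <= cabs z ^+ k.
  by rewrite cabsM cabs_real cabsX ler_piMl ?exprn_ge0 ?cabs_ge0.
have r01 : 0 <= cabs z < 1 by rewrite cabs_ge0.
have /cvg_ex[x /= hx] : cvgn (series (fun k => complex.Re ((a k)%:C * z ^+ k))).
  apply: series_dominated_cvg r01 _ => k.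
  exact: le_trans (Re_le_cabs _) (t1 k).
have /cvg_ex[y /= hy] : cvgn (series (fun k => complex.Im ((a k)%:C * z ^+ k))).
  apply: series_dominated_cvg r01 _ => k.
  exact: le_trans (Im_le_cabs _) (t1 k).
exists (x +i* y) => n; apply/ler_addgt0Pr => e e0.
have e20 : 0 < e / 2 by rewrite divr_gt0.
move: hx => /cvgrPdistC_lt /(_ _ e20) [N1 _ h1].
move: hy => /cvgrPdistC_lt /(_ _ e20) [N2 _ h2].
pose m := (n + maxn N1 N2)%N.
have -> : psum a z n - (x +i* y)
  = (psum a z m - (x +i* y)) - (psum a z m - psum a z n) by ring.
rewrite (le_trans (cabsD _ _)) // addrC cabsN lerD ?cabs_psumB //.
apply: le_trans (cabs_le_ReIm _) _; rewrite (splitr e) lerD //; apply: ltW.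
  have := h1 m; rewrite /= /series /= -Re_sum => h.
  rewrite ReD; apply: h; rewrite /m; lia.
have := h2 m; rewrite /= /series /= -Im_sum => h.
rewrite ImD; apply: h; rewrite /m; lia.
Qed.

Lemma psum_bound_cvg (R : realType) (a : nat -> R) (z l : R[i]) (r : R) :
  0 <= r < 1 -> (forall n, cabs (psum a z n - l) <= r ^+ n / (1 - r)) ->
  psum a z @ \oo --> l.
Proof.
move=> /andP[r0 r1] h; apply/complex_cvgP => e e0.
have z0 : 0 < 1 - r by rewrite subr_gt0.
have [N hN] := expr_small r0 r1 (mulr_gt0 e0 z0).
by exists N => n Nn; rewrite (le_lt_trans (h n)) // ltr_pdivrMr // hN.
Qed.

Lemma psum_rate (R : realType) (a : nat -> R) (z l : R[i]) N :
  (forall k, `|a k| <= 1) -> cabs z < 1 -> psum a z @ \oo --> l ->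
  cabs (psum a z N - l) <= cabs z ^+ N / (1 - cabs z).
Proof.
move=> a1 z1 /complex_cvgP al; apply/ler_addgt0Pr => e /al [m hm].
have -> : psum a z N - l
  = (psum a z (N + m) - l) - (psum a z (N + m) - psum a z N) by ring.
rewrite (le_trans (cabsD _ _)) // addrC cabsN lerD ?cabs_psumB //.
by rewrite ltW // hm // leq_addl.
Qed.

(** * Compactness of coefficient sequences and limits of zeros *)

(** By Tychonoff the sequences have a cluster point in the product of unit intervals. Neighbourhoods
    there control finitely many coordinates, hence the bound [k < N]. *)
Lemma unit_interval_seq_cluster (R : realType) (a : nat -> nat -> R) :
  (forall j k, 0 <= a j k <= 1) ->
  exists2 b : nat -> R, (forall k, 0 <= b k <= 1) &
    forall (d : R) N J, 0 < d ->
      exists2 j, (J <= j)%N & forall k, (k < N)%N -> `|b k - a j k| < d.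
Proof.
move=> a01.
have := @tychonoff nat (fun=> R) (fun=> [set` `[0, 1]]) (fun=> @segment_compact R 0 1).
move=> /(_ (a @ \oo) _)[|b [b01 hb]].
  by exists 0%N => // n _ k /=; rewrite in_itv /= a01.
exists b => [k|d N J d0]; first by have := b01 k; rewrite /= in_itv.
have nb : nbhs b [set c : nat -> R | forall k, (k < N)%N -> `|b k - c k| < d].
  elim: N => [|N IH]; first by apply: filterE.
  have : nbhs b [set c : nat -> R | `|b N - c N| < d].
    have := @proj_continuous nat (fun=> R) N b.
    move=> /(_ [set x | `|b N - x| < d]); apply.
    by apply/nbhs_ballP; exists d => //=; rewrite -ball_normE.
  move=> /filterI /(_ IH); apply: filterS => c /= [h1 h2] k.
  by rewrite ltnS leq_eqVlt => /orP[/eqP -> //|/h2].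
have [|c [[j /= Jj <-] hj]] := hb [set c | exists2 j, (J <= j)%N & a j = c] _ _ nb.
  by exists J => // n Jn; exists n.
by exists j.
Qed.

Lemma psum_recl1 (R : rcfType) (a : nat -> R) (z : R[i]) n : a 0%N = 1 ->
  psum a z n.+1 = 1 + \sum_(1 <= k < n.+1) (a k)%:C * z ^+ k.
Proof. by move=> a0; rewrite /psum big_ltn // a0 expr0 mulr1. Qed.

(** Prepending the coefficient 1 turns the series into [psum]; of the function on the disk only its
    vanishing at [w] remains. *)
Lemma calGP (R : realType) (w : R[i]) : calG `[0, 1] w <->
  cabs w < 1 /\
  (exists a : nat -> R, [/\ a 0%N = 1, (forall i, 0 <= a i <= 1) &
     psum a w @ \oo --> (0 : R[i])]).
Proof.
rewrite /calG /unit_disk /= cabs_lt1; split.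
  move=> [w1 [f [a a01 fa] fw]]; split => //.
  exists (fun i => if i is _.+1 then a i else 1); split => //.
    by case=> [|i]; rewrite ?ler01 ?lexx //; have := a01 i.+1 isT; rewrite in_itv.
  have := fa w; rewrite cabs_lt1 fw => /(_ w1) /complex_cvgP h.
  (* The shift to [N.+1] excludes the empty partial sum, which lacks the constant term 1. *)
  apply/complex_cvgP => e /h [N hN]; exists N.+1 => -[//|n] /ltnW /hN hn.
  rewrite psum_recl1 //; move: hn.
  suff -> : \sum_(1 <= k < n.+1) (a k)%:C * w ^+ k = \sum_(1 <= k < n.+1)
      (if k is _.+1 then a k else 1)%:C * w ^+ k by [].
  by apply: eq_big_nat => -[].
move=> [w1 [a [a0 a01 aw]]]; split => //.
have a1 k : `|a k| <= 1 by rewrite ger0_norm; case/andP: (a01 k).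
(* The sum of the series inside the disk, with value 0 imposed at [w]; outside the disk 0 is a
   default. *)
have /choice [f hf] : forall z, exists l : R[i],
    (cabs z < 1 -> psum a z @ \oo --> l) /\ (z = w -> l = 0).
  move=> z; have [->|zw] := eqVneq z w; first by exists 0.
  have [z1|z1] := boolP (cabs z < 1); last by exists 0; split=> // /(negP z1).
  have [l hl] := psum_cvg a1 z1; exists l.
  by split=> [_|/eqP]; [apply: (psum_bound_cvg _ hl); rewrite cabs_ge0 z1|rewrite (negPf zw)].
exists f; last by case: (hf w) => _ ->.
exists a => [i _|z]; first by rewrite in_itv /= a01.
rewrite cabs_lt1 => z1; have [/(_ z1) /complex_cvgP h _] := hf z.
apply/complex_cvgP => e /h [N hN]; exists N.+1 => n Nn.
by case: n Nn => // n Nn; have := hN n.+1 (ltnW Nn); rewrite psum_recl1.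
Qed.

Lemma cabs_subrX (R : rcfType) (x y : R[i]) n : cabs x <= 1 -> cabs y <= 1 ->
  cabs (x ^+ n - y ^+ n) <= n%:R * cabs (x - y).
Proof.
move=> x1 y1; elim: n => [|n IH]; first by rewrite subrr cabs0 mul0r.
have -> : x ^+ n.+1 - y ^+ n.+1 = x * (x ^+ n - y ^+ n) + (x - y) * y ^+ n.
  by rewrite !exprS; ring.
rewrite (le_trans (cabsD _ _)) // !cabsM cabsX -natr1 mulrDl mul1r lerD //.
  by apply: le_trans IH; rewrite ler_piMl ?cabs_ge0.
by rewrite ler_piMr ?cabs_ge0 // exprn_ile1 ?cabs_ge0.
Qed.

Lemma cabs_psum_perturb (R : rcfType) (a b : nat -> R) (z w : R[i]) (d : R) N :
  (forall k, `|a k| <= 1) -> cabs z <= 1 -> cabs w <= 1 ->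
  (forall k, (k < N)%N -> `|a k - b k| <= d) ->
  cabs (psum a z N - psum b w N) <= N%:R * d + (N * N)%:R * cabs (z - w).
Proof.
move=> a1 z1 w1 abd; rewrite /psum -sumrB (le_trans (cabs_sum _ _ _)) //.
have -> : N%:R * d + (N * N)%:R * cabs (z - w)
    = \sum_(0 <= k < N) (d + N%:R * cabs (z - w)).
  by rewrite sumr_const_nat subn0 natrM -mulr_natl; ring.
apply: ler_sum_nat => k /andP[_ kN].
have -> : (a k)%:C * z ^+ k - (b k)%:C * w ^+ k
    = (a k - b k)%:C * w ^+ k + (a k)%:C * (z ^+ k - w ^+ k).
  by rewrite rmorphB /=; ring.
rewrite (le_trans (cabsD _ _)) // lerD // cabsM cabs_real.
  rewrite -[leRHS]mulr1 ler_pM ?cabs_ge0 ?abd //.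
  by rewrite cabsX exprn_ile1 ?cabs_ge0.
rewrite -[leRHS]mul1r ler_pM ?cabs_ge0 //.
rewrite (le_trans (cabs_subrX _ z1 w1)) // ler_wpM2r ?cabs_ge0 //.
by rewrite ler_nat ltnW.
Qed.

(** Take zeros v_j tending to w and a cluster point b of their coefficient sequences. The v_j
    eventually stay in a disk of radius r < 1, so their partial sums are at most r^N / (1 - r)
    uniformly in j, and this bound passes to b at w. *)
Lemma calG_limit (R : realType) (w : R[i]) : cabs w < 1 ->
  (forall e : R, 0 < e -> exists2 v, calG `[0, 1] v & cabs (w - v) < e) ->
  calG `[0, 1] w.
Proof.
move=> w1 h; apply/calGP; split=> //.
have /choice [v hv] : forall j : nat, exists v : R[i],
    calG `[0, 1] v /\ cabs (w - v) < j.+1%:R^-1.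
  by move=> j; have [|v] := h j.+1%:R^-1; [rewrite invr_gt0|exists v].
have /choice [a ha] : forall j : nat, exists a : nat -> R,
    [/\ a 0%N = 1, (forall i, 0 <= a i <= 1) & psum a (v j) @ \oo --> (0 : R[i])].
  by move=> j; case: (hv j) => /calGP [].
have [b b01 hb] := unit_interval_seq_cluster (fun j => let: And3 _ h _ := ha j in h).
exists b; split => //.
  apply/eqP; rewrite -subr_eq0 -normr_le0; apply/ler_addgt0Pr => e e0.
  have [j _ /(_ 0%N isT)] := hb e 1%N 0%N e0; have [-> _ _] := ha j.
  by rewrite add0r => /ltW.
have b1 k : `|b k| <= 1 by rewrite ger0_norm; case/andP: (b01 k).
pose r := (1 + cabs w) / 2.
have w0 := cabs_ge0 w.
have r01 : 0 <= r < 1 by rewrite /r; apply/andP; split; lra.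
have z0 : 0 < 1 - r by case/andP: r01; rewrite subr_gt0.
apply: (psum_bound_cvg r01) => N; rewrite subr0; apply/ler_addgt0Pr => e e0.
(* Both perturbations, of the coefficients and of the point, will cost at most (N + N^2) d <= e. *)
pose d := e / (N%:R + (N * N)%:R + 1).
have N0 : 0 <= N%:R + (N * N)%:R :> R by rewrite addr_ge0.
have d0 : 0 < d by rewrite divr_gt0 // ltr_wpDl.
(* The second bound keeps v_j within radius r, the midpoint of |w| and 1. *)
pose d' := Num.min d ((1 - cabs w) / 2).
have d'0 : 0 < d' by rewrite lt_min d0 /=; lra.
have [J hJ] : exists J, forall j, (J <= j)%N -> j.+1%:R^-1 < d'.
  exists (Num.truncn d'^-1) => j Jj; rewrite -[ltRHS]invrK ltf_pV2 ?posrE ?invr_gt0 //.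
  by rewrite (lt_le_trans (truncnS_gt _)) // ler_nat ltnS.
have [j Jj hj] := hb d N J d0; have [_ aj01 aj] := ha j; have [_ vj] := hv j.
have wv : cabs (w - v j) < d' := lt_trans vj (hJ _ Jj).
have [wvd wv1] : cabs (w - v j) < d /\ cabs (w - v j) < (1 - cabs w) / 2.
  by move: wv; rewrite lt_min => /andP.
have vr : cabs (v j) <= r.
  have -> : v j = w - (w - v j) by ring.
  by rewrite (le_trans (cabsD _ _)) // cabsN /r; lra.
have v1 : cabs (v j) < 1 by case/andP: r01 => _; apply: le_lt_trans.
have aj1 k : `|a j k| <= 1 by rewrite ger0_norm; case/andP: (aj01 k).
have := psum_rate N aj1 v1 aj; rewrite subr0 => hrate.
have hpert : cabs (psum b w N - psum (a j) (v j) N)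
    <= N%:R * d + (N * N)%:R * cabs (w - v j).
  by apply: cabs_psum_perturb => //; rewrite ?ltW // => k /hj/ltW.
have -> : psum b w N = (psum b w N - psum (a j) (v j) N) + psum (a j) (v j) N.
  by ring.
rewrite (le_trans (cabsD _ _)) // addrC lerD //.
  apply: (le_trans hrate); apply: ler_pM.
  - by rewrite exprn_ge0 ?cabs_ge0.
  - by rewrite invr_ge0 subr_ge0 ltW.
  - by apply: lerXn2r; rewrite ?nnegrE ?cabs_ge0 //; case/andP: r01.
  - by rewrite lef_pV2 ?posrE ?(subr_gt0 _ (cabs _)) ?subr_gt0 ?(andP r01).2 //; lra.
rewrite (le_trans hpert) // (_ : e = d * (N%:R + (N * N)%:R + 1)); last first.
  by rewrite mulfVK // gt_eqF // ltr_wpDl.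
rewrite (@le_trans _ _ (N%:R * d + (N * N)%:R * d)) //.
  by rewrite lerD // ler_wpM2l // ltW.
by rewrite -mulrDl mulrC ler_pM2l // lerDl.
Qed.

(** * The right-hand side of the theorem *)

Definition target (R : realType) : set R[i] :=
  closure (@unit_disk R) `|` [set - z^-1 | z in @calG R `[0, 1]].

Lemma closure_unit_diskP (R : realType) (z : R[i]) :
  closure (@unit_disk R) z <-> cabs z <= 1.
Proof.
rewrite complex_closureP; split=> [h|z1 e e0].
  apply/ler_addgt0Pr => e /h [a]; rewrite /unit_disk /= cabs_lt1 => a1 za.
  have -> : z = a + (z - a) by ring.
  by rewrite (le_trans (cabsD _ _)) // lerD // ltW.
have e1 : 0 < 1 + e by lra.
exists (((1 + e)^-1)%:C * z).
  rewrite /unit_disk /= cabs_lt1 cabsM cabs_real ger0_norm ?invr_ge0 ?ltW //.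
  by rewrite mulrC ltr_pdivrMr // mul1r; lra.
have -> : z - ((1 + e)^-1)%:C * z = (e / (1 + e))%:C * z.
  rewrite (_ : e / (1 + e) = 1 - (1 + e)^-1) ?rmorphB /= ?mulrBl ?mul1r //.
  by field; lra.
rewrite cabsM cabs_real ger0_norm ?divr_ge0 ?ltW //.
rewrite (le_lt_trans (ler_piMr _ z1)) ?divr_ge0 ?ltW //.
by rewrite ltr_pdivrMr // mulrDr mulr1 ltrDl mulr_gt0.
Qed.

Lemma targetP (R : realType) (z : R[i]) :
  target z <-> (1 < cabs z -> calG `[0, 1] (- z^-1)).
Proof.
rewrite /target; split=> [[/closure_unit_diskP z1|[w Gw <-]] z2|h].
- by rewrite ltNge z1 in z2.
- by rewrite invrN invrK opprK.
have [z1|z1] := leP (cabs z) 1; first by left; apply/closure_unit_diskP.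
by right; exists (- z^-1); [exact: h|rewrite invrN invrK opprK].
Qed.

(** Only points outside the closed disk are constrained, and there inversion does not increase
    distances: |1/z - 1/v| = |z - v| / |z v|. *)
Lemma closure_target (R : realType) (A : set R[i]) :
  A `<=` @target R -> closure A `<=` @target R.
Proof.
move=> At z /complex_closureP cA; apply/targetP => z1.
have z0 : 0 < cabs z by lra.
have zu : z != 0 by rewrite -cabs_gt0.
apply: calG_limit; first by rewrite cabsN cabsV invf_lt1.
move=> e e0.
pose d := Num.min e (cabs z - 1).
have [|v /At/targetP Av] := cA d; first by rewrite lt_min e0 subr_gt0.
rewrite lt_min => /andP[zve zv1].
have v1 : 1 < cabs v.
  have : cabs z <= cabs (z - v) + cabs v by rewrite -{1}(subrK v z) cabsD.
  by lra.
exists (- v^-1); first exact: Av.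
have vu : v != 0 by rewrite -cabs_gt0; lra.
have -> : - z^-1 - - v^-1 = (z - v) / (z * v) by field; rewrite zu vu.
rewrite cabsM cabsV cabsM ltr_pdivrMr; last by rewrite mulr_gt0 //; lra.
rewrite (lt_trans zve) // ltr_pMr //.
by rewrite -[ltLHS]mulr1 ltr_pM ?ler01.
Qed.

(** * The orbit of 1 under the negative beta-transformation *)

Lemma tau_E1 (R : realType) (beta x : R) :
  tau beta E1 x = (Ibeta beta x).+1%:R - beta * x.
Proof. by rewrite /tau /Tbeta /E1 /= expr1 -natr1; ring. Qed.

Lemma tau_E1_itv (R : realType) (beta x : R) : 0 <= beta -> 0 <= x ->
  0 <= tau beta E1 x <= 1.
Proof.
move=> b0 x0; rewrite tau_E1 /Ibeta.
have := truncn_itv (mulr_ge0 b0 x0); rewrite -natr1 => /andP[h1 h2].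
by apply/andP; split; lra.
Qed.

Definition orbit1 (R : realType) (beta : R) (n : nat) : R :=
  tau_iter beta E1 1 n.

Arguments orbit1 : simpl never.

(** This is d_n; the successor is the contribution of E = 1. *)
Definition digit1 (R : realType) (beta : R) (n : nat) : nat :=
  (Ibeta beta (orbit1 beta n)).+1.

Lemma orbit1S (R : realType) (beta : R) n :
  orbit1 beta n.+1 = (digit1 beta n)%:R - beta * orbit1 beta n.
Proof. by rewrite /orbit1 /tau_iter iterS tau_E1. Qed.

Lemma orbit1_itv (R : realType) (beta : R) n : 0 <= beta ->
  0 <= orbit1 beta n <= 1.
Proof.
move=> b0; elim: n => [|n /andP[h _]]; first by rewrite ler01 lexx.
exact: tau_E1_itv.
Qed.

(** Here s_n = (-1)^n, a sign that passes into the power of [- z]. *)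
Lemma phi_term_E1 (R : realType) (beta : R) (z : R[i]) n :
  phi_term beta E1 z n = - ((digit1 beta n)%:R * (- z) ^+ n.+1).
Proof.
rewrite /phi_term /s_ /e_ /d_ /E1 /= prodr_const card_ord expr1 /digit1.
rewrite -[in RHS]natr1 rmorphM rmorphXn rmorphN rmorphD !rmorph1 /=.
by rewrite rmorph_nat [in RHS]exprNn [in RHS]exprS; ring.
Qed.

Lemma phi_last_term_E1 (R : realType) (beta x : R) (z : R[i]) n :
  (beta * x * s_ beta E1 1 n)%:C * z ^+ n.+1
  = - (beta%:C * x%:C * (- z) ^+ n.+1).
Proof.
rewrite /s_ /e_ /E1 /= prodr_const card_ord expr1.
rewrite rmorphM rmorphXn rmorphN rmorph1 rmorphM /=.
by rewrite [in RHS]exprNn [in RHS]exprS; ring.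
Qed.

(** Writing d_k = x_(k+1) + beta x_k makes the sum telescope. The leftover x_n w^n tends to 0 in the
    disk; for a simple base it merges with the last term of phi into one more term of [psum]. *)
Lemma one_minus_phi (R : realType) (beta : R) (z : R[i]) n :
  1 - \sum_(0 <= k < n) phi_term beta E1 z k
  = (1 + beta%:C * - z) * psum (orbit1 beta) (- z) n
    + (orbit1 beta n)%:C * (- z) ^+ n.
Proof.
elim: n => [|n IH].
  by rewrite /psum !big_nil mulr0 add0r expr0 mulr1 subr0.
rewrite big_nat_recr //= opprD addrA IH phi_term_E1 psumS orbit1S.
by rewrite rmorphB rmorphM /= rmorph_nat exprS; ring.
Qed.

(** * Orbit polynomials and Galois conjugates *)

(** The polynomial D_n: the digits of beta are kept and the multiplier beta becomes ['X]. The
    coefficients are integers, placed in [rat] to be compared with minimal polynomials. *)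
Fixpoint orbit_poly (R : realType) (beta : R) (n : nat) : {poly rat} :=
  if n is m.+1 then (digit1 beta m)%:R - 'X * orbit_poly beta m else 1.

Lemma orbit_poly_horner (R : realType) (beta : R) (S : numFieldType) (z : S) n :
  (map_poly ratr (orbit_poly beta n.+1)).[z]
  = (digit1 beta n)%:R - z * (map_poly ratr (orbit_poly beta n)).[z].
Proof.
by rewrite /= rmorphB rmorphM /= map_polyX rmorph_nat !hornerE hornerMn hornerC.
Qed.

Lemma orbit_polyE (R : realType) (beta : R) n :
  (map_poly ratr (orbit_poly beta n)).[beta] = orbit1 beta n.
Proof.
elim: n => [|n IH]; first by rewrite /= rmorph1 hornerC.
by rewrite orbit_poly_horner IH orbit1S.
Qed.

(** The remainder of q modulo the minimal polynomial vanishes at beta, so by minimality it is 0. *)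
Lemma galois_conjugate_root (R : realType) (beta : R) (z : R[i]) (q : {poly rat}) :
  galois_conjugate beta z -> root (map_poly (ratr : rat -> R) q) beta ->
  root (map_poly (ratr : rat -> R[i]) q) z.
Proof.
move=> [p [[pm pb pmin] pz _]] qb.
have p0 : p != 0 by apply: monic_neq0.
have [r0|rn0] := eqVneq (q %% p) 0.
  have := divp_eq q p; rewrite r0 addr0 => ->.
  by rewrite rmorphM rootM pz orbT.
have : root (map_poly (ratr : rat -> R) (q %% p)) beta.
  have := qb; rewrite {1}(divp_eq q p) rmorphD rmorphM /= /root hornerD hornerM.
  by rewrite (eqP pb) mulr0 add0r.
by move=> /(pmin _ rn0); rewrite leqNgt ltn_modp p0.
Qed.

(** D_n(z) obeys the recurrence of x_n with z in place of beta. Weighted by powers of - 1 / z the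
    difference telescopes, so bounded D_n(z) force the series of the x_n to vanish at - 1 / z when
    |z| > 1 and z differs from beta. *)
Lemma orbit_poly_conjugate (R : realType) (beta : R) (z : R[i]) n :
  z != 0 ->
  (1 + beta%:C * - z^-1) * psum (orbit1 beta) (- z^-1) n
  = ((map_poly ratr (orbit_poly beta n)).[z] - (orbit1 beta n)%:C)
    * (- z^-1) ^+ n.
Proof.
move=> z0; elim: n => [|n IH].
  by rewrite /psum big_nil mulr0 /= rmorph1 hornerC subrr mul0r.
rewrite psumS mulrDr IH orbit_poly_horner orbit1S.
by rewrite rmorphB rmorphM /= rmorph_nat exprS; field.
Qed.

(** * Inclusions into the right-hand side *)

Lemma geometric_bound_cvg0 (R : realType) (u : nat -> R[i]) (c : R[i]) (K r : R) :
  c != 0 -> 0 <= r < 1 -> (forall n, cabs (c * u n) <= K * r ^+ n) ->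
  u @ \oo --> (0 : R[i]).
Proof.
move=> c0 /andP[r0 r1] h; apply/complex_cvgP => e e0.
have c1 : 0 < cabs c by rewrite cabs_gt0.
have K1 : 0 < `|K| + 1 by rewrite ltr_wpDl.
have [N hN] := expr_small r0 r1 (divr_gt0 (mulr_gt0 c1 e0) K1).
exists N => n /hN; rewrite subr0 ltr_pdivlMr // => hn.
rewrite -(ltr_pM2l c1) -cabsM (le_lt_trans (h n)) // (le_lt_trans _ hn) //.
by rewrite mulrC ler_wpM2l ?exprn_ge0 // (le_trans (ler_norm K)) // lerDl ler01.
Qed.

Lemma orbit1_calG (R : realType) (beta : R) (w : R[i]) (K : R) : 0 <= beta ->
  cabs w < 1 -> 1 + beta%:C * w != 0 ->
  (forall n, cabs ((1 + beta%:C * w) * psum (orbit1 beta) w n) <= K * cabs w ^+ n) ->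
  calG `[0, 1] w.
Proof.
move=> b0 w1 c0 h; apply/calGP; split => //; exists (orbit1 beta); split => //.
  by move=> i; apply: orbit1_itv.
by apply: (geometric_bound_cvg0 c0 _ h); rewrite cabs_ge0.
Qed.

Lemma factor_neq0 (R : realType) (beta : R) (z : R[i]) : beta != 0 ->
  z != (beta^-1)%:C -> 1 + beta%:C * - z != 0.
Proof.
move=> b0; apply: contra => /eqP h; apply/eqP; rewrite fmorphV /=.
have b1 : beta%:C != 0 by rewrite fmorph_eq0.
apply: (mulfI b1); rewrite mulfV //.
by apply/eqP; rewrite eq_sym -subr_eq0 -mulrN h.
Qed.

(** D_n(z) depends only on x_n: if x_n = x_m then D_n - D_m vanishes at beta, hence at z. A finite
    orbit thus leaves finitely many values. *)
Lemma gen_parry_bound (R : realType) (beta : R) (z : R[i]) :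
  gen_parry beta E1 -> galois_conjugate beta z ->
  exists B, forall n, cabs (map_poly ratr (orbit_poly beta n)).[z] <= B.
Proof.
move=> /finite_seqP [s hs] gz.
have same n m : orbit1 beta n = orbit1 beta m ->
    (map_poly ratr (orbit_poly beta n)).[z] = (map_poly ratr (orbit_poly beta m)).[z].
  move=> nm; have : root (map_poly (ratr : rat -> R[i])
      (orbit_poly beta n - orbit_poly beta m)) z.
    apply: galois_conjugate_root gz _.
    by rewrite rmorphB /root !hornerE !orbit_polyE nm subrr.
  by rewrite rmorphB /root !hornerE subr_eq0 => /eqP.
suff [B hB] : exists B, forall n, orbit1 beta n \in s ->
    cabs (map_poly ratr (orbit_poly beta n)).[z] <= B.
  exists B => n; apply: hB.
  by have : [set` s] (orbit1 beta n) by rewrite -hs; exists n.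
elim: s {hs} => [|y s [B hB]]; first by exists 0.
have [[m my]|no] := pselect (exists m, orbit1 beta m = y).
  exists (Num.max B (cabs (map_poly ratr (orbit_poly beta m)).[z])) => n.
  rewrite inE le_max => /orP[/eqP ny|/hB -> //].
  by rewrite (same n m) ?lexx ?orbT // ny.
exists B => n; rewrite inE => /orP[/eqP ny|/hB -> //].
by case: no; exists n.
Qed.

Lemma Phi_hat_sub_target (R : realType) : Phi_hat E1 `<=` @target R.
Proof.
apply: closure_target => z [beta [[b1 _] gp gz]].
have b0 : 0 < beta by apply: lt_trans b1.
apply/targetP => z1.
have z0 : z != 0 by rewrite -cabs_gt0; lra.
have w1 : cabs (- z^-1) < 1 by rewrite cabsN cabsV invf_lt1 //; lra.
have [B hB] := gen_parry_bound gp gz.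
(* [B] bounds |D_n(z)| and 1 bounds x_n. *)
apply: (@orbit1_calG _ beta _ (B + 1)) => //; first exact: ltW.
  apply: factor_neq0; first exact: lt0r_neq0.
  by case: gz => p [_ _]; rewrite fmorphV (inj_eq invr_inj).
move=> n; rewrite orbit_poly_conjugate // cabsM cabsX.
rewrite ler_wpM2r ?exprn_ge0 ?cabs_ge0 // (le_trans (cabsD _ _)) // lerD //.
by rewrite cabsN cabs_real; have /andP[h1 h2] := orbit1_itv n (ltW b0); rewrite ger0_norm.
Qed.

Lemma phi_zero_series_calG (R : realType) (beta : R) (z : R[i]) : 1 < beta ->
  cabs z < 1 -> z != (beta^-1)%:C ->
  series (phi_term beta E1 z) @ \oo --> (1 : R[i]) -> calG `[0, 1] (- z).
Proof.
move=> b1 z1 zb /complex_cvgP hs.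
have b0 : 0 < beta by apply: lt_trans b1.
have c0 := factor_neq0 (lt0r_neq0 b0) zb.
apply/calGP; rewrite cabsN; split=> //; exists (orbit1 beta).
split=> // [i|]; first by apply: orbit1_itv; apply: ltW.
apply/complex_cvgP => e e0.
have c1 : 0 < cabs (1 + beta%:C * - z) by rewrite cabs_gt0.
(* One half is for the partial sums of 1 - phi, the other for the leftover x_n w^n. *)
have ce : 0 < cabs (1 + beta%:C * - z) * e / 2 by rewrite divr_gt0 // mulr_gt0.
have [N1 h1] := hs _ ce.
have [N2 h2] := expr_small (cabs_ge0 z) z1 ce.
exists (maxn N1 N2) => n; rewrite geq_max => /andP[/h1 {}h1 /h2 {}h2].
rewrite subr0 -(ltr_pM2l c1) -cabsM.
have -> : (1 + beta%:C * - z) * psum (orbit1 beta) (- z) n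
   = (1 - series (phi_term beta E1 z) n) - (orbit1 beta n)%:C * (- z) ^+ n.
  by rewrite /series /= one_minus_phi; ring.
rewrite (le_lt_trans (cabsD _ _)) // (splitr (_ * e)) ltr_leD //.
  by rewrite cabsB.
rewrite cabsN cabsM cabs_real cabsX cabsN (le_trans _ (ltW h2)) //.
have /andP[x0 x1] := orbit1_itv n (ltW b0).
by rewrite ler_piMl ?exprn_ge0 ?cabs_ge0 // ger0_norm.
Qed.

Lemma Phi_star_sub_target (R : realType) : Phi_star E1 `<=` @target R.
Proof.
apply: closure_target => _ [z [beta [[b1 _] [w phiw /eqP w0] zb]] <-].
have {w0} w0 : w = 1 by apply/eqP; rewrite eq_sym -subr_eq0.
subst w.
have b0 : 0 < beta by apply: lt_trans b1.
apply/targetP; rewrite invrK => z1'.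
have z1 : cabs z < 1.
  have [->|z0] := eqVneq z 0; first by rewrite cabs0.
  by move: z1'; rewrite cabsV invf_gt1 // cabs_gt0.
case: phiw => [[N [N1 _ _] w1]|[_ _ [P [Q [h Qz /esym w1]]]]|[_ _ _]].
- apply/calGP; rewrite cabsN; split=> //.
  (* For a simple base 1 - phi is (1 + beta w) times the sum of x_n w^n over n <= N, so the
     coefficients are cut off after [N], although the orbit goes on. *)
  exists (fun n => if (n <= N)%N then orbit1 beta n else 0); split => //.
    move=> i; case: ifP => _; last by rewrite lexx ler01.
    by apply: orbit1_itv; apply: ltW.
  have hz : psum (orbit1 beta) (- z) N.+1 = 0.
    have c0 := factor_neq0 (lt0r_neq0 b0) zb.
    apply: (mulfI c0); rewrite mulr0 psumS mulrDr.
    have /eqP := w1; rewrite -subr_eq0 opprD addrA one_minus_phi => /eqP <-.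
    by rewrite phi_last_term_E1 -/(orbit1 beta N) [in RHS]exprS; ring.
  apply/complex_cvgP => e e0; exists N.+1 => n Nn; rewrite subr0.
  suff -> : psum (fun n => if (n <= N)%N then orbit1 beta n else 0) (- z) n = 0.
    by rewrite cabs0.
  rewrite /psum (@big_cat_nat _ _ _ N.+1) //= [X in _ + X]big1_seq ?addr0.
    rewrite -[RHS]hz; apply: eq_big_nat => i /andP[_].
    by rewrite ltnS => ->.
  move=> i /andP[_]; rewrite mem_index_iota => /andP[Ni _].
  by rewrite leqNgt Ni mul0r.
(* Inside the disk and away from poles the rational extension is the sum of the series. *)
- by apply: (phi_zero_series_calG b1) => //; rewrite -w1; apply: h; rewrite ?cabs_lt1.
- exact: phi_zero_series_calG.
Qed.

(** * Inclusions of [Phi] into the other two sets *)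

(** From x_N = k / beta the digit is k + 1 and x_(N+1) = 1, so the orbit is periodic. *)
Lemma simple_gen_parry (R : realType) (beta : R) : 1 < beta ->
  is_simple beta E1 -> gen_parry beta E1.
Proof.
move=> b1 [N [_ [k [_ xk]]]].
have b0 : beta != 0 by rewrite gt_eqF // (lt_trans _ b1).
have x1 : tau_iter beta E1 1 N.+1 = 1.
  rewrite -[LHS]/(orbit1 beta N.+1) orbit1S /digit1 /Ibeta /orbit1 xk.
  by rewrite mulrC divfK // natrK -natr1 addrAC subrr add0r.
apply: (@sub_finite_set _ _ (tau_iter beta E1 1 @` `I_N.+1)); last first.
  exact/finite_image/finite_II.
move=> _ [n _ <-]; exists (n %% N.+1)%N; first by rewrite /= ltn_mod.
rewrite {2}(divn_eq n N.+1); elim: (n %/ N.+1)%N => [//|q IH].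
by rewrite IH mulSn -addnA [in RHS]addnC {2}/tau_iter iterD -/(tau_iter beta E1 1 N.+1) x1.
Qed.

Lemma Phi_sub_Phi_hat (R : realType) : Phi E1 `<=` @Phi_hat R E1.
Proof.
apply: closureS => z [beta [bb sb gz]]; exists beta; split=> //.
by apply: simple_gen_parry => //; case: bb.
Qed.

(** The relation beta x_N = k carries over to z D_N(z) = k. As the terms of 1 - phi(1/z) without the
    last one add up to D_N(z) (- 1 / z)^N, the last term cancels them. *)
Lemma Phi_sub_Phi_star (R : realType) : Phi E1 `<=` @Phi_star R E1.
Proof.
apply: closureS => z [beta [bb [n nEP] gz]].
have b1 : 1 < beta by case: bb.
have b0 : 0 < beta by apply: lt_trans b1.
have ex : exists n, `[< (1 <= n)%N /\ EP beta (tau_iter beta E1 1 n) >].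
  by exists n; apply/asboolP.
case: (ex_minnP ex) => N /asboolP [N1 NEP] Nmin.
have [k [/andP[k1 _] xk]] := NEP.
have zk : z * (map_poly ratr (orbit_poly beta N)).[z] = k%:R.
  have : root (map_poly (ratr : rat -> R[i]) ('X * orbit_poly beta N - k%:R)) z.
    apply: galois_conjugate_root gz _.
    rewrite rmorphB rmorphM /= map_polyX rmorph_nat /root !hornerE hornerMn hornerC.
    by rewrite orbit_polyE /orbit1 xk mulrC divfK ?subrr // gt_eqF.
  rewrite rmorphB rmorphM /= map_polyX rmorph_nat /root !hornerE hornerMn hornerC.
  by rewrite subr_eq0 => /eqP.
have z0 : z != 0.
  apply/eqP => z0; move/eqP: zk; rewrite z0 mul0r eq_sym pnatr_eq0.
  by rewrite -leqn0 leqNgt k1.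
exists z^-1; last by rewrite invrK.
exists beta; split=> //; last first.
  by case: gz => p [_ _]; rewrite fmorphV (inj_eq invr_inj).
eexists.
  apply: Or31; exists N; last reflexivity.
  split=> // m /andP[m1 mN] mEP.
  have : (N <= m)%N by apply: Nmin; apply/asboolP.
  by rewrite leqNgt mN.
rewrite opprD addrA one_minus_phi orbit_poly_conjugate // -mulrDl subrK.
rewrite phi_last_term_E1 xk -rmorphM /= mulrCA divff ?gt_eqF // mulr1.
by rewrite rmorph_nat -zk exprS; field.
Qed.

(** * Simple bases with prescribed digits *)

(** |p(y)| is the product of the distances from y to the roots; were all of them at least e, it
    would be at least e to the degree. *)
Lemma monic_root_near (R : rcfType) (p : {poly R[i]}) (y : R[i]) (e : R) :
  p \is monic -> 0 < e -> cabs p.[y] < e ^+ (size p).-1 ->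
  exists2 r, root p r & cabs (y - r) < e.
Proof.
move=> pm e0 hp; have [rs prs] := closed_field_poly_normal p.
rewrite (monicP pm) scale1r in prs.
have [/hasP[r rrs hr]|/hasPn no] := boolP (has (fun r => cabs (y - r) < e) rs).
  by exists r => //; rewrite prs root_prod_XsubC.
move: hp; rewrite prs size_prod_XsubC /= horner_prod ltNge => /negP[].
elim: rs no {prs} => [|r rs IH] no; first by rewrite big_nil cabs1.
rewrite big_cons cabsM exprS ler_pM ?exprn_ge0 ?(ltW e0) //.
  by rewrite hornerXsubC leNgt no ?mem_head.
by apply: IH => s srs; rewrite no // inE srs orbT.
Qed.

(** Synthetic division by y + b: the h_(i+1) are the coefficients of the quotient, and h_0 = 0 says
    that there is no remainder. *)
Lemma backward_telescope (S : comNzRingType) (b y : S) (h c : nat -> S) n :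
  h 0%N = 0 -> (forall i, b * h i.+1 + h i = c i) ->
  (y + b) * \sum_(0 <= i < n) h i.+1 * y ^+ i
  = h n * y ^+ n + \sum_(0 <= i < n) c i * y ^+ i.
Proof.
move=> h0 hc; elim: n => [|n IH]; first by rewrite !big_nil mulr0 h0 mul0r addr0.
by rewrite !big_nat_recr //= mulrDr IH -hc exprS; ring.
Qed.

(* backward_orbit c b j is x_(N+1-j), and c i is the digit d_(N-i). *)
Fixpoint backward_orbit (F : fieldType) (c : nat -> nat) (b : F) (j : nat) : F :=
  if j is i.+1 then ((c i)%:R - backward_orbit c b i) / b else 0.

Lemma backward_orbitE (F : fieldType) (c : nat -> nat) (b : F) j : b != 0 ->
  b * backward_orbit c b j.+1 + backward_orbit c b j = (c j)%:R.
Proof. by move=> b0 /=; field. Qed.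

(* With p(Y) = Y^(N+1) + \sum_(i <= N) c_i Y^i, which vanishes at - beta, this is
   p(- X) up to the sign that makes it monic. *)
Definition conj_poly (S : nzRingType) (N : nat) (c : nat -> nat) : {poly S} :=
  \poly_(i < N.+2) ((-1) ^+ (N.+1 + i) * (if i == N.+1 then 1 else (c i)%:R)).

Lemma map_conj_poly (S T : nzRingType) (f : {rmorphism S -> T}) N c :
  map_poly f (conj_poly S N c) = conj_poly T N c.
Proof.
apply/polyP => i; rewrite coef_map /= !coef_poly; case: ifP => _; last exact: rmorph0.
by rewrite rmorphM rmorphXn rmorphN1; case: ifP => _; rewrite ?rmorph1 ?rmorph_nat.
Qed.

Lemma conj_poly_monic (S : nzRingType) N c :
  (size (conj_poly S N c) = N.+2) * (conj_poly S N c \is monic).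
Proof.
have sz : size (conj_poly S N c) = N.+2.
  by rewrite size_poly_eq // eqxx mulr1 addnn -signr_odd odd_double oner_neq0.
split => //; rewrite monicE lead_coefE sz coef_poly ltnSn eqxx mulr1.
by rewrite addnn -signr_odd odd_double.
Qed.

Lemma conj_poly_horner (S : comNzRingType) N c (z : S) :
  (conj_poly S N c).[z]
  = (-1) ^+ N.+1 * ((- z) ^+ N.+1 + \sum_(0 <= i < N.+1) (c i)%:R * (- z) ^+ i).
Proof.
rewrite horner_poly big_ord_recr /= eqxx mulr1 mulrDr addrC; congr (_ + _).
  by rewrite exprD (exprNn z); ring.
rewrite big_mkord mulr_sumr; apply: eq_bigr => i _.
by rewrite ltn_eqF // exprD (exprNn z); ring.
Qed.

Lemma conj_poly_irreducible N (c : nat -> nat) :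
  (forall i, (i <= N)%N -> ~~ odd (c i)) -> ~~ (4 %| c 0)%N ->
  irreducible_poly (conj_poly int N c).
Proof.
move=> ceven c0; have [sz mon] := conj_poly_monic int N c.
apply: (@eisenstein_crit 2) => //; rewrite ?sz //.
- by rewrite (monicP mon).
- rewrite coef_poly /= dvdzE abszM abszX /= exp1n mul1n.
  by rewrite natz.
move=> i; rewrite coef_poly /= => iN; rewrite ltnS ltnW // ltn_eqF //.
by rewrite dvdzE abszM abszX /= exp1n mul1n natz /= dvdn2 ceven.
Qed.

(** By Gauss q is irreducible over the rationals. Its gcd with any r vanishing at beta is not
    constant, hence associate to q, so q divides r. *)
Lemma irreducible_is_minpoly (R : realType) (beta : R) (q : {poly int}) :
  q \is monic -> irreducible_poly q -> root (map_poly (intr : int -> R) q) beta ->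
  is_minpoly beta (map_poly intr q).
Proof.
move=> qm /irreducible_rat_int [_ qirr] qb.
have qbR : root (map_poly (ratr : rat -> R) (map_poly intr q)) beta.
  rewrite -map_poly_comp; move: qb; congr (root _ _); apply: eq_map_poly => i /=.
  by rewrite ratr_int.
split => // [|r r0 rb]; first exact: monic_map.
set p := map_poly _ q in qbR qirr *.
have pm : p \is monic by apply: monic_map.
have gb : root (map_poly (ratr : rat -> R) (gcdp p r)) beta.
  by rewrite gcdp_map root_gcd qbR.
have g0 : gcdp p r != 0 by rewrite gcdp_eq0 negb_and r0 orbT.
have g1 : size (gcdp p r) != 1%N.
  apply/negP => /eqP g1; have := root_size_gt1 _ gb.
  by rewrite size_map_poly g1 map_poly_eq0 => /(_ g0).
have := qirr _ g1 (dvdp_gcdl _ _) => /eqp_size <-.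
by rewrite dvdp_leq ?dvdp_gcdr.
Qed.

(** If h is in [0, 1] and the digit in [2, b], their difference is in [1, b], and division by b
    lands in (0, 1]. *)
Lemma backward_orbit_itv (R : realFieldType) (c : nat -> nat) (b : R) N :
  0 < b -> (forall i, (i < N)%N -> (2 <= c i)%N /\ (c i)%:R <= b) ->
  forall j, (j <= N)%N -> 0 <= backward_orbit c b j <= 1 /\
    ((0 < j)%N -> 0 < backward_orbit c b j).
Proof.
move=> b0 hc; elim=> [|j IH] jN; first by rewrite lexx ler01.
have [/andP[h0 h1] _] := IH (ltnW jN); have [c2 cb] := hc _ jN.
have c2' : 2 <= (c j)%:R :> R by rewrite ler_nat.
have p : 0 < backward_orbit c b j.+1 by rewrite /= divr_gt0 //; lra.
by split=> // ; rewrite (ltW p) /= ler_pdivrMr //; lra.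
Qed.

(** Synthetic division at y = - b. Hence a nonzero b is a root exactly when the backward orbit ends
    at x_0 = 1. *)
Lemma conj_poly_real (R : realFieldType) N c (b : R) : b != 0 ->
  (conj_poly R N c).[b] = b ^+ N.+1 * (1 - backward_orbit c b N.+1).
Proof.
move=> b0; rewrite conj_poly_horner.
have := @backward_telescope R b (- b) (backward_orbit c b) (fun i => (c i)%:R) N.+1.
move=> /(_ erefl (fun i => backward_orbitE c i b0)); rewrite addNr mul0r.
move=> /esym/eqP; rewrite addrC addr_eq0 => /eqP ->.
rewrite (exprNn b); have := sqrr_sign R (N.+1); rewrite expr2 => h.
transitivity ((-1) ^+ N.+1 * (-1) ^+ N.+1 * (b ^+ N.+1 * (1 - backward_orbit c b N.+1))); first by ring.
by rewrite h mul1r.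
Qed.

(** x_0 = (c_N - x_1) / b with x_1 in [0, 1] is at least 1 for b = c_N - 1 and at most 1 for b =
    c_N, so the polynomial changes sign. *)
Lemma exists_base_root (R : rcfType) (N : nat) (c : nat -> nat) :
  (forall i, (i < N)%N -> (2 <= c i < c N)%N) -> (2 <= c N)%N ->
  exists2 b : R, (c N)%:R - 1 <= b <= (c N)%:R & (conj_poly R N c).[b] = 0.
Proof.
move=> hc cN; have cN' : 2 <= (c N)%:R :> R by rewrite ler_nat.
have bnd (b : R) : (c N)%:R - 1 <= b -> 0 <= backward_orbit c b N <= 1.
  move=> hb; have b0 : 0 < b by lra.
  have h2 i : (i < N)%N -> (2 <= c i)%N /\ (c i)%:R <= b.
    move=> /hc /andP[c2 cl]; split=> //; apply: le_trans hb.
    by rewrite lerBrDr natr1 ler_nat.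
  by case: (backward_orbit_itv b0 h2 (leqnn N)).
have le1 : (c N)%:R - 1 <= (c N)%:R :> R by lra.
have [|b hb /rootP rb] := @poly_ivt R (conj_poly R N c) _ _ le1; last by exists b.
have u0 : 0 < (c N)%:R - 1 :> R by lra.
have v0 : 0 < (c N)%:R :> R by lra.
rewrite !conj_poly_real ?gt_eqF //.
have /andP[h0 h1] := bnd _ (lexx _); have /andP[k0 k1] := bnd _ le1.
rewrite pmulr_rle0 ?exprn_gt0 // pmulr_rge0 ?exprn_gt0 // subr_le0 subr_ge0 /=.
by rewrite ler_pdivlMr // ler_pdivrMr // !mul1r; apply/andP; split; lra.
Qed.

Lemma truncn_backward_digit (R : realType) (k : nat) (h : R) :
  (0 < k)%N -> 0 < h <= 1 -> (Num.truncn (k%:R - h)).+1 = k.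
Proof.
case: k => // k _ /andP[h0 h1]; congr S; apply: truncn_def.
by rewrite -natr1; apply/andP; split; lra.
Qed.

(** For n < N the value x_(n+1) is positive, so the floor of beta x_n = c_(N-n) - x_(n+1) gives back
    the digit. This fails at n = N: the backward orbit starts from 0, while the true orbit returns
    to 1. *)
Lemma orbit1_backward (R : realType) (N : nat) (c : nat -> nat) (beta : R) :
  0 < beta -> (forall i, (i < N)%N -> (2 <= c i)%N /\ (c i)%:R <= beta) ->
  (0 < c N)%N -> backward_orbit c beta N.+1 = 1 ->
  forall n, (n <= N)%N -> orbit1 beta n = backward_orbit c beta (N.+1 - n).
Proof.
move=> b0 hc cN h1; elim=> [|n IH] nN; first by rewrite subn0 h1.
rewrite orbit1S /digit1 IH ?(ltnW nN) // subSS subSn ?(ltnW nN) //.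
have bh := backward_orbitE c (N - n) (lt0r_neq0 b0).
have [] := backward_orbit_itv b0 hc (leq_subr n N).
rewrite subn_gt0 => /andP[_ hle] /(_ nN) h0.
rewrite /Ibeta; move: bh; set h' := backward_orbit c beta (N - n).+1 => bh.
have -> : beta * h' = (c (N - n)%N)%:R - backward_orbit c beta (N - n) by rewrite -bh; ring.
rewrite truncn_backward_digit ?h0 //; first by ring.
have : (N - n <= N)%N by apply: leq_subr.
by rewrite leq_eqVlt => /orP[/eqP -> //|/hc[]]; lia.
Qed.

Lemma digits_simple_base (R : realType) (N : nat) (c : nat -> nat) (beta : R) :
  (0 < N)%N -> (forall i, (i < N)%N -> (2 <= c i < c N)%N) ->
  (forall i, (i <= N)%N -> ~~ odd (c i)) -> ~~ (4 %| c 0)%N ->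
  (c N)%:R - 1 <= beta -> (conj_poly R N c).[beta] = 0 ->
  [/\ base beta, is_simple beta E1 & is_minpoly beta (map_poly intr (conj_poly int N c))].
Proof.
move=> N0 hc ceven c04 hb rb.
have c0 := hc _ N0.
have b2 : 2 <= beta.
  by apply: le_trans hb; rewrite lerBrDr natr1 ler_nat; lia.
have b0 : 0 < beta by lra.
have mp : is_minpoly beta (map_poly intr (conj_poly int N c)).
  apply: irreducible_is_minpoly; first by rewrite conj_poly_monic.
    exact: conj_poly_irreducible.
  by rewrite map_conj_poly /root rb.
have h1 : backward_orbit c beta N.+1 = 1.
  apply/eqP; move/eqP: rb; rewrite (conj_poly_real N c (lt0r_neq0 b0)) mulf_eq0.
  by rewrite expf_eq0 gt_eqF //= subr_eq0 eq_sym.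
have hc' i : (i < N)%N -> (2 <= c i)%N /\ (c i)%:R <= beta.
  move=> /hc /andP[c2 cl]; split=> //; apply: le_trans hb.
  by rewrite lerBrDr natr1 ler_nat.
split => //.
  split; first by lra.
  (* An integer base would be a root of X - m, but the minimal polynomial has degree N + 1 >= 2. *)
  apply/negP => /intrP [m bm].
  case: mp => _ _ /(_ ('X - (m%:~R)%:P)); rewrite polyXsubC_eq0 => /(_ isT).
  rewrite rmorphB /= map_polyX map_polyC /= ratr_int root_XsubC bm eqxx => /(_ isT).
  by rewrite size_XsubC map_conj_poly conj_poly_monic; lia.
exists N; split=> //; exists (c 0%N); split.
  by rewrite truncn_ge_nat ?(ltW b0) // (hc' _ N0).2; lia.
have cN : (0 < c N)%N by lia.
have := orbit1_backward b0 hc' cN h1 (leqnn N).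
by rewrite /orbit1 subSnn => -> /=; rewrite subr0.
Qed.

(** * Approximating roots by conjugates of simple bases *)

Lemma approximating_digits (R : realType) (N M : nat) (b : nat -> R) :
  (0 < N)%N -> (forall i, (i < N)%N -> 0 <= b i <= 1) -> b N = 1 -> (0 < M)%N ->
  exists c beta, [/\ base beta, is_simple beta E1,
    is_minpoly beta (map_poly intr (conj_poly int N c)),
    4 * M%:R <= beta &
    forall i, (i <= N)%N -> `|backward_orbit c beta i.+1 - b i| <= 2 / M%:R].
Proof.
move=> N0 b01 bN M0.
(* The lower digits are 2 modulo 4, as Eisenstein requires of c_0, and at most 4 M + 2; the even top
   digit exceeds them all. *)
pose c i := if i == N then (4 * M + 4)%N else (4 * Num.truncn (b i * M%:R) + 2)%N.
have M0' : 0 < M%:R :> R by rewrite ltr0n.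
have tr i : (i < N)%N -> (Num.truncn (b i * M%:R) <= M)%N /\
    (Num.truncn (b i * M%:R))%:R <= b i * M%:R < (Num.truncn (b i * M%:R))%:R + 1.
  move=> /b01 /andP[h0 h1]; have p0 := mulr_ge0 h0 (ltW M0').
  have p1 : b i * M%:R <= M%:R by rewrite ler_piMl ?(ltW M0').
  by rewrite natr1 truncn_itv // -(ler_nat R) (le_trans _ p1) ?truncn_le.
have cN : c N = (4 * M + 4)%N by rewrite /c eqxx.
have hc i : (i < N)%N -> (2 <= c i < c N)%N.
  by move=> iN; rewrite cN /c ltn_eqF //; have [] := tr _ iN; lia.
have [|beta /andP[bl bu] rb] := @exists_base_root R N c hc; first by rewrite cN; lia.
have bl' : 4 * M%:R + 3 <= beta.
  by move: bl; rewrite cN natrD natrM; lra.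
have b0 : 0 < beta by lra.
have ceven i : (i <= N)%N -> ~~ odd (c i).
  by rewrite /c; case: eqP => _ _; rewrite oddD oddM.
have c04 : ~~ (4 %| c 0)%N.
  by rewrite /c ltn_eqF // dvdn_addr ?dvdn_mulr.
have [bb bs bm] := digits_simple_base N0 hc ceven c04 bl rb.
exists c, beta; split=> //; first by lra.
have hc' i : (i < N)%N -> (2 <= c i)%N /\ (c i)%:R <= beta.
  move=> /hc /andP[c2 cl]; split=> //; apply: le_trans bl.
  by rewrite lerBrDr natr1 ler_nat.
move=> i; rewrite leq_eqVlt => /orP[/eqP ->|iN].
  have : (conj_poly R N c).[beta] == 0 by rewrite rb.
  rewrite (conj_poly_real N c (lt0r_neq0 b0)) mulf_eq0 expf_eq0 gt_eqF //= subr_eq0 => /eqP h.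
  by rewrite -h bN subrr normr0 divr_ge0.
have [/andP[h0 h1] _] := backward_orbit_itv b0 hc' (ltnW iN).
have bh := backward_orbitE c i (lt0r_neq0 b0).
have [_ /andP[t1 t2]] := tr _ iN; have /andP[q0 q1] := b01 _ iN.
rewrite -(ler_pM2l b0) -{1}(gtr0_norm b0) -normrM mulrBr.
have ci : (c i)%:R = 4 * (Num.truncn (b i * M%:R))%:R + 2 :> R.
  by rewrite /c ltn_eqF // natrD natrM.
(* Multiplied by beta, the error comes from the floor, the summand 2, the previous backward value in
   [0, 1] and beta <= 4 M + 4, in all at most 8; beta >= 4 M turns this into 2 / M. *)
apply: (@le_trans _ _ 8); last first.
  by rewrite mulrA ler_pdivlMr //; lra.
have e1 : 4 * M%:R * b i <= beta * b i by rewrite ler_wpM2r //; lra.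
have e2 : beta * b i <= (4 * M%:R + 4) * b i.
  by rewrite ler_wpM2r //; move: bu; rewrite cN natrD natrM.
have bh' : beta * backward_orbit c beta i.+1 = (c i)%:R - backward_orbit c beta i.
  by rewrite -bh; ring.
by rewrite bh' ci ler_norml; apply/andP; split; nra.
Qed.

(** The monic quotient H of the base's polynomial by Y + beta has coefficients close to the b_i, so
    it has a root r near - z. Then - r is a root of the minimal polynomial of beta, near z. *)
Lemma root_mem_Phi (R : realType) (N : nat) (b : nat -> R) (z : R[i]) :
  (forall i, (i < N)%N -> 0 <= b i <= 1) -> b N = 1 -> psum b (- z) N.+1 = 0 ->
  Phi E1 z.
Proof.
move=> b01 bN hz.
have N0 : (0 < N)%N.
  case: N bN hz {b01} => // b1 /eqP.
  by rewrite /psum big_nat1 expr0 mulr1 b1 oner_eq0.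
apply/complex_closureP => e e0.
pose y := - z; pose S : R := \sum_(0 <= i < N.+1) cabs y ^+ i.
have S0 : 0 <= S by apply: sumr_ge0 => i _; rewrite exprn_ge0 // cabs_ge0.
have eN : 0 < e ^+ N by rewrite exprn_gt0.
(* The first summand makes |H(y)| < e^N; the second makes beta exceed |r|, so that - r differs from
   beta. *)
pose M := (Num.truncn (2 * S / e ^+ N) + Num.truncn (cabs y + e)).+1.
have M1 : 2 * S / e ^+ N < M%:R.
  by rewrite (lt_le_trans (truncnS_gt _)) // ler_nat /M ltnS leq_addr.
have M2 : cabs y + e < M%:R.
  by rewrite (lt_le_trans (truncnS_gt _)) // ler_nat /M ltnS leq_addl.
have M0 : 0 < M%:R :> R by rewrite ltr0n.
have [c [beta [bb bs bm bM hb]]] := approximating_digits N0 b01 bN (isT : (0 < M)%N).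
have b0 : 0 < beta by case: bb => b1 _; apply: lt_trans b1.
pose h i := backward_orbit c beta i.
have h1 : h N.+1 = 1.
  have := bm => -[_ /eqP rb _]; move: rb.
  rewrite -map_poly_comp (_ : map_poly _ _ = conj_poly R N c); last first.
    rewrite -(map_conj_poly (intr : int -> R)); apply: eq_map_poly => i /=.
    by rewrite ratr_int.
  rewrite (conj_poly_real N c (lt0r_neq0 b0)) => /eqP.
  by rewrite mulf_eq0 expf_eq0 gt_eqF //= subr_eq0 => /eqP.
pose H := \poly_(i < N.+1) (h i.+1)%:C.
have Hn : (h N.+1)%:C != 0 by rewrite h1 oner_eq0.
have sH : size H = N.+1 by rewrite size_poly_eq.
have Hm : H \is monic by rewrite monicE lead_coefE sH coef_poly ltnSn /= h1.
have Hpsum u : H.[u] = psum (fun i => h i.+1) u N.+1.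
  by rewrite horner_poly /psum big_mkord.
have Hy : cabs H.[y] < e ^+ (size H).-1.
  rewrite sH Hpsum /= -[psum _ _ _]subr0 -hz /psum -sumrB.
  apply: (@le_lt_trans _ _ (2 / M%:R * S)); last first.
    by rewrite mulrAC ltr_pdivrMr // [ltRHS]mulrC -ltr_pdivrMr.
  rewrite (le_trans (cabs_sum _ _ _)) // mulr_sumr; apply: ler_sum_nat => i /andP[_ iN].
  rewrite -mulrBl -rmorphB /= cabsM cabs_real cabsX ler_wpM2r ?exprn_ge0 ?cabs_ge0 //.
  exact: hb.
have [r rH yr] := monic_root_near Hm e0 Hy.
exists (- r); last by rewrite opprK -cabsN opprD.
exists beta; split=> //; exists (map_poly intr (conj_poly int N c)); split=> //.
  rewrite -map_poly_comp (_ : map_poly _ _ = conj_poly R[i] N c); last first.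
    rewrite -(map_conj_poly (intr : int -> R[i])); apply: eq_map_poly => i /=.
    by rewrite ratr_int.
  rewrite /root conj_poly_horner opprK.
  have bC : beta%:C != 0 by rewrite fmorph_eq0 gt_eqF.
  have := @backward_telescope _ beta%:C r (fun i => (h i)%:C) (fun i => (c i)%:R) N.+1.
  rewrite -/(psum (fun i => h i.+1) r N.+1) -Hpsum (eqP rH) mulr0 h1 mul1r => <-.
  - by rewrite mulr0.
  - by [].
  - by move=> i; rewrite -rmorphM -rmorphD /= backward_orbitE ?rmorph_nat ?gt_eqF.
apply/eqP => rb; have : cabs r <= cabs y + e.
  have -> : r = y - (y - r) by ring.
  by rewrite (le_trans (cabsD _ _)) // (cabsN (y - r)) lerD // ltW.
rewrite -cabsN rb cabs_real gtr0_norm //.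
by apply/negP; rewrite -ltNge; lra.
Qed.

(** * Small numbers as values of polynomials with small nonnegative coefficients *)

(* Squaring at least doubles the slope |Im w / Re w| as long as Re w > 0. *)
Lemma Re_iter_square_le0 (R : rcfType) n (w : R[i]) : complex.Im w != 0 ->
  complex.Re w <= 2 ^+ n * `|complex.Im w| ->
  exists k, complex.Re (w ^+ (2 ^ k)) <= 0.
Proof.
have sq (v : R[i]) : complex.Re (v ^+ 2) = complex.Re v ^+ 2 - complex.Im v ^+ 2 /\
    complex.Im (v ^+ 2) = 2 * (complex.Re v * complex.Im v).
  by case: v => a b; rewrite expr2 /=; split; ring.
elim: n w => [|n IH] w iw hw; have [r0|r0] := leP (complex.Re w) 0;
  try by exists 0%N; rewrite expn0 expr1.
  exists 1%N; rewrite expn1 (sq w).1 subr_le0 -[leRHS]real_normK ?num_real //.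
  by rewrite expr0 mul1r in hw; apply: lerXn2r; rewrite ?nnegrE ?(ltW r0).
have [||k hk] := IH (w ^+ 2).
- by rewrite (sq w).2 mulf_neq0 ?pnatr_eq0 // mulf_neq0 // (lt0r_neq0 r0).
- rewrite (sq w).1 (sq w).2 !normrM (gtr0_norm r0) normr_nat.
  rewrite (@le_trans _ _ (complex.Re w ^+ 2)) ?lerBlDr ?lerDl ?sqr_ge0 //.
  by rewrite expr2 (le_trans (ler_wpM2l (ltW r0) hw)) // exprS; lra.
by exists k.+1; rewrite expnS exprM.
Qed.

Definition not_nneg_real (R : rcfType) (w : R[i]) : Prop :=
  complex.Im w != 0 \/ complex.Re w < 0.

Lemma exists_iter_square_Re_le0 (R : realType) (w : R[i]) : not_nneg_real w ->
  exists k, complex.Re (w ^+ (2 ^ k)) <= 0.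
Proof.
case=> [iw|rw]; last by exists 0%N; rewrite expn0 expr1 ltW.
have i0 : 0 < `|complex.Im w| by rewrite normr_gt0.
(* This n exceeds Re w / |Im w|, and n < 2^n. *)
pose n := (Num.truncn (complex.Re w / `|complex.Im w|)).+1.
apply: (@Re_iter_square_le0 _ n) => //; rewrite -ler_pdivrMr //.
apply: le_trans (ltW (truncnS_gt _)) _.
by rewrite -natrX ler_nat -/n; apply/ltnW/ltn_expl.
Qed.

Lemma not_nneg_real_neq0 (R : rcfType) (w : R[i]) : not_nneg_real w -> w != 0.
Proof. by move=> h; apply/eqP => w0; move: h; rewrite w0 => -[] /=; rewrite ?eqxx ?ltxx. Qed.

Lemma positive_relation (R : realType) (w : R[i]) : not_nneg_real w ->
  exists p : {poly R}, [/\ forall i, 0 <= p`_i, 0 < p`_0, 0 < p`_1 &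
    root (map_poly (real_complex R) p) w].
Proof.
move=> hw; have [k hk] := exists_iter_square_Re_le0 hw.
have w0 := not_nneg_real_neq0 hw.
set v := w ^+ (2 ^ k) in hk.
have v0 : v != 0 by rewrite expf_neq0.
pose s := complex.Re v ^+ 2 + complex.Im v ^+ 2.
have s0 : 0 < s.
  rewrite lt_neqAle addr_ge0 ?sqr_ge0 // andbT eq_sym.
  apply: contra v0; rewrite paddr_eq0 ?sqr_ge0 // !sqrf_eq0.
  by move=> h; rewrite eq_complex.
have vq : v ^+ 2 + (- 2 * complex.Re v)%:C * v + s%:C = 0.
  rewrite /s; case: (v) => a b.
  by apply/eqP; rewrite eq_complex expr2 /=; apply/andP; split; apply/eqP; ring.
clearbody s.
(* p vanishes at w because v is a root of X^2 - 2 Re(v) X + |v|^2; the factor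
   1 + X then makes the coefficient of X positive. *)
pose p : {poly R} := 'X^(2 ^ k * 2) + (- 2 * complex.Re v) *: 'X^(2 ^ k) + s%:P.
have pn i : 0 <= p`_i.
  rewrite !coefD coefZ !coefXn coefC !addr_ge0 ?ler0n //.
    by rewrite mulr_ge0 ?ler0n //; lra.
  by case: eqP => // _; apply: ltW.
have p0 : 0 < p`_0.
  rewrite !coefD coefZ !coefXn coefC eqxx -!(eq_sym (_ ^ _ * _)%N) -!(eq_sym (_ ^ _)%N).
  by rewrite muln_eq0 expn_eq0 /= mulr0 !add0r.
have pw : root (map_poly (real_complex R) p) w.
  rewrite /root !rmorphD /= map_polyZ !map_polyXn map_polyC !hornerE exprM -/v.
  exact/eqP.
exists (p * (1 + 'X)); split.
- by move=> i; rewrite mulrDr mulr1 coefD coefMX addr_ge0 //; case: eqP.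
- by rewrite mulrDr mulr1 coefD coefMX /= addr0.
- by rewrite mulrDr mulr1 coefD coefMX /= ltr_wpDl.
- by rewrite rmorphM rootM pw.
Qed.

Lemma psum_coef (R : rcfType) (q : {poly R}) (w : R[i]) n : (size q <= n)%N ->
  psum (fun i => q`_i) w n = (map_poly (real_complex R) q).[w].
Proof.
move=> qn; rewrite (horner_coef_wide _ (leq_trans (size_poly _ _) qn)) /psum big_mkord.
by apply: eq_bigr => i _; rewrite coef_map.
Qed.

(** Adding t p, with p(w) = 0, leaves the value of x + y X at w unchanged and lifts its two
    coefficients above 0, because p_0 and p_1 are positive. *)
Lemma small_affine_representable (R : realType) (w : R[i]) (d : R) :
  not_nneg_real w -> 0 < d ->
  exists (m : nat) (eta : R), 0 < eta /\
    forall x y : R, `|x| <= eta -> `|y| <= eta ->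
      exists2 q : {poly R}, (size q <= m)%N /\ (forall i, 0 <= q`_i <= d) &
        (map_poly (real_complex R) q).[w] = x%:C + y%:C * w.
Proof.
move=> hw d0; have [p [pn p0 p1 pw]] := positive_relation hw.
pose B := 1 + \sum_(i < size p) p`_i.
have pB i : p`_i <= B.
  have S0 (r : pred 'I_(size p)) : 0 <= \sum_(i < size p | r i) p`_i by apply: sumr_ge0.
  have [ip|ip] := ltnP i (size p); last first.
    by rewrite nth_default // addr_ge0 // S0.
  by rewrite /B (bigD1 (Ordinal ip)) //= addrCA lerDl addr_ge0 // S0.
have B0 : 0 < B by apply: lt_le_trans p0 (pB 0%N).
(* [B] bounds the coefficients of p, so those of t p are at most d / 2, which leaves d / 2 for x and
   y. *)
pose t := d / (2 * B).
have t0 : 0 < t by rewrite divr_gt0 // mulr_gt0.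
have tp i : t * p`_i <= d / 2.
  rewrite (le_trans (ler_wpM2l (ltW t0) (pB i))) // /t invfM mulrA mulfVK ?gt_eqF //.
exists (maxn 2 (size p)), (Num.min (d / 2) (Num.min (t * p`_0) (t * p`_1))).
split; first by rewrite !lt_min divr_gt0 //= (mulr_gt0 t0 p0) (mulr_gt0 t0 p1).
move=> x y; rewrite !le_min => /and3P[x1 x2 x3] /and3P[y1 y2 y3].
exists (x%:P + y *: 'X + t *: p); last first.
  rewrite !rmorphD /= !map_polyZ map_polyX map_polyC !hornerE (eqP pw).
  by rewrite mulr0 addr0.
split.
  rewrite (leq_trans (size_polyD _ _)) // geq_max leq_max (leq_trans (size_scale_leq _ _)) ?leq_maxr ?orbT ?andbT //.
  apply/orP; left; rewrite (leq_trans (size_polyD _ _)) // geq_max.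
  rewrite (leq_trans (size_polyC_leq1 _)) //= (leq_trans (size_scale_leq _ _)) ?size_polyX //.
move=> i; rewrite !coefD !coefZ coefC coefX.
have := tp i; move: x1 x2 x3 y1 y2 y3; rewrite !ler_norml.
case: i => [|[|i]] /=; rewrite ?mulr0 ?mulr1 ?addr0 ?add0r.
- by move=> /andP[? ?] /andP[? ?] *; apply/andP; split; lra.
- by move=> _ _ _ /andP[? ?] _ /andP[? ?] *; apply/andP; split; lra.
- by move=> *; rewrite mulr_ge0 ?(ltW t0) //=; lra.
Qed.

(** A nonreal w forms with 1 a real basis of the plane, so u = x + y w; for real w only real u are
    reached, with y = 0. The degree bound [m] is uniform in u. *)
Lemma small_representable (R : realType) (w : R[i]) (d : R) :
  not_nneg_real w -> 0 < d ->
  exists (m : nat) (eta : R), 0 < eta /\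
    forall u : R[i], cabs u < eta -> (complex.Im w = 0 -> complex.Im u = 0) ->
      exists2 q : nat -> R, (forall i, 0 <= q i <= d) &
        forall n, (m <= n)%N -> psum q w n = u.
Proof.
move=> hw d0; have [m [eta [eta0 h]]] := small_affine_representable hw d0.
have [iw0|iw0] := eqVneq (complex.Im w) 0.
  exists m, eta; split=> // u ueta /(_ iw0) iu0.
  have [||q [qm qd] qw] := h (complex.Re u) 0.
  - by rewrite (le_trans (Re_le_cabs _)) // ltW.
  - by rewrite normr0 ltW.
  exists (fun i => q`_i) => // n mn; rewrite psum_coef ?(leq_trans qm) // qw.
  by rewrite rmorph0 mul0r addr0; apply/eqP; rewrite eq_complex /= iu0 !eqxx.
(* For u = x + y w both |x| and |y| are at most C |u|. *)
pose C := 1 + `|complex.Im w|^-1 * (1 + `|complex.Re w|).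
have i0 : 0 < `|complex.Im w|^-1 by rewrite invr_gt0 normr_gt0.
have C1 : 0 < C by rewrite ltr_wpDr // mulr_ge0 // ltW.
exists m, (eta / C); split; first by rewrite divr_gt0.
move=> u; rewrite ltr_pdivlMr // => ueta _.
have u0 := cabs_ge0 u.
pose y := complex.Im u / complex.Im w; pose x := complex.Re u - y * complex.Re w.
have hy : `|y| <= cabs u * `|complex.Im w|^-1.
  by rewrite /y normrM normfV ler_wpM2r ?(ltW i0) ?Im_le_cabs.
have hx : `|x| <= cabs u + cabs u * `|complex.Im w|^-1 * `|complex.Re w|.
  by rewrite (le_trans (ler_normB _ _)) // normrM lerD ?Re_le_cabs // ler_wpM2r.
have p1 : 0 <= cabs u * `|complex.Im w|^-1 by rewrite mulr_ge0 // ltW.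
have p2 : 0 <= cabs u * `|complex.Im w|^-1 * `|complex.Re w| by rewrite mulr_ge0.
have uC : cabs u * C = cabs u + cabs u * `|complex.Im w|^-1
    + cabs u * `|complex.Im w|^-1 * `|complex.Re w| by rewrite /C; ring.
have [||q [qm qd] qw] := h x y; [lra..|].
exists (fun i => q`_i) => // n mn; rewrite psum_coef ?(leq_trans qm) // qw.
rewrite /x /y; move: iw0; case: (w) => a b; case: (u) => c d' /= b0.
by apply/eqP; rewrite eq_complex /=; apply/andP; split; apply/eqP; field.
Qed.

(** * Points of the closed disk *)

(** For large N the leading term (- z)^N is small enough to be cancelled by lower terms with
    coefficients in [0, 1]. *)
Lemma nonreal_disk_Phi (R : realType) (z : R[i]) :
  cabs z < 1 -> complex.Im z != 0 -> Phi E1 z.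
Proof.
move=> z1 iz; have iy : complex.Im (- z) != 0 by case: z iz {z1} => a b /=; rewrite oppr_eq0.
have [m [eta [eta0 h]]] := small_representable (or_introl iy) (@ltr01 R).
have [N0 hN0] := expr_small (cabs_ge0 z) z1 eta0.
pose N := maxn m N0.
have [||q q01 qN] := h (- (- z) ^+ N).
- by rewrite cabsN cabsX cabsN hN0 // leq_maxr.
- by move/eqP: iy.
apply: (@root_mem_Phi _ N (fun i => if i == N then 1 else q i)).
- by move=> i iN; rewrite ltn_eqF.
- by rewrite eqxx.
rewrite psumS eqxx mul1r; apply/eqP; rewrite addr_eq0 -(qN N) ?leq_maxl //.
by apply/eqP; apply: eq_big_nat => i /andP[_ iN]; rewrite ltn_eqF.
Qed.

Lemma Phi_closed (R : realType) (A : set R[i]) : A `<=` Phi E1 ->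
  closure A `<=` Phi E1.
Proof.
move=> h; apply: subset_trans (closureS h) _.
by rewrite /Phi -(closure_id _).1 //; exact: closed_closure.
Qed.

Lemma unit_disk_Phi (R : realType) : closure (@unit_disk R) `<=` Phi E1.
Proof.
apply: Phi_closed => z; rewrite /unit_disk /= cabs_lt1 => z1.
apply: (@Phi_closed _ [set z | cabs z < 1 /\ complex.Im z != 0]).
  by move=> v [v1 iv]; apply: nonreal_disk_Phi.
apply/complex_closureP => e e0.
have [iz|iz] := eqVneq (complex.Im z) 0; last by exists z; rewrite ?subrr ?cabs0.
pose s := Num.min e (1 - cabs z) / 2.
have s0 : 0 < s by rewrite divr_gt0 // lt_min e0 subr_gt0.
have [se sz] : s < e /\ s < 1 - cabs z.
  have m0 : 0 < Num.min e (1 - cabs z) by rewrite lt_min e0 subr_gt0.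
  have : s < Num.min e (1 - cabs z) by rewrite /s; lra.
  by rewrite lt_min => /andP.
have cs : cabs (0 +i* s) = s.
  apply/eqP; rewrite eq_le; apply/andP; split.
    by have := cabs_le_ReIm (0 +i* s); rewrite /= normr0 add0r gtr0_norm.
  by have := Im_le_cabs (0 +i* s); rewrite /= gtr0_norm.
exists (z + (0 +i* s)); last by rewrite opprD addrA subrr add0r cabsN cs.
split; first by rewrite (le_lt_trans (cabsD _ _)) // cs; lra.
by rewrite ImD iz add0r gt_eqF.
Qed.

(** * Points outside the closed disk *)

Lemma psum_real (R : rcfType) (a : nat -> R) (w : R[i]) n : complex.Im w = 0 ->
  psum a w n = (\sum_(0 <= k < n) a k * complex.Re w ^+ k)%:C.
Proof.
move=> iw; rewrite rmorph_sum /=; apply: eq_bigr => k _.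
rewrite rmorphM rmorphXn /=; congr (_ * _ ^+ _).
by apply/eqP; rewrite eq_complex /= iw !eqxx.
Qed.

(** At a nonnegative real point every nonempty partial sum is at least the constant term 1. *)
Lemma calG_not_nneg_real (R : realType) (w : R[i]) : calG `[0, 1] w ->
  not_nneg_real w.
Proof.
move=> /calGP [_ [a [a0 a01 aw]]].
have [iw|iw] := eqVneq (complex.Im w) 0; last by left.
right; rewrite ltNge; apply/negP => rw.
have [N hN] := (complex_cvgP _ _).1 aw _ (@ltr01 R).
have := hN N.+1 (leqnSn N); rewrite subr0 psum_real // cabs_real.
rewrite big_nat_recl // expr0 mulr1 a0.
have S0 : 0 <= \sum_(0 <= i < N) a i.+1 * complex.Re w ^+ i.+1.
  by apply: sumr_ge0 => i _; rewrite mulr_ge0 ?exprn_ge0 //; case/andP: (a01 i.+1).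
by rewrite ger0_norm ?addr_ge0 // ltNge lerDl S0.
Qed.

(** The reciprocal polynomial: the constant coefficient b_0 = 1 becomes the leading one, as
    [root_mem_Phi] demands. *)
Lemma psum_rev (R : rcfType) (b : nat -> R) (w : R[i]) L : w != 0 ->
  psum (fun i => b (L - i)%N) w^-1 L.+1 = w^-1 ^+ L * psum b w L.+1.
Proof.
move=> w0; rewrite /psum [in RHS]big_nat_rev /= mulr_sumr; apply: eq_big_nat => i /andP[_ iL].
rewrite add0n subSS mulrCA; congr (_ * _).
by rewrite -{1}(subnK (iL : (i <= L)%N)) exprD -mulrA mulrCA -exprMn mulVf // expr1n mulr1.
Qed.

(** At the dilated point v = (1 + t) w the coefficients a_n / (1 + t)^n with n >= 1 are at most 1 /
    (1 + t). The room t / (1 + t) left below 1 absorbs the correction that makes a truncated series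
    vanish exactly at v. *)
Lemma calG_Phi (R : realType) (w : R[i]) : calG `[0, 1] w -> Phi E1 (- w^-1).
Proof.
move=> Gw; have hw := calG_not_nneg_real Gw.
have w0 := not_nneg_real_neq0 hw.
case/calGP: Gw => w1 [a [a0 a01 aw]].
apply: (@Phi_closed R _ (fun _ => id)); apply/complex_closureP => e e0.
have cw : 0 < cabs w by rewrite cabs_gt0.
(* With this t the distance from 1 / w to 1 / v is e / (1 + t) < e. *)
pose t := e * cabs w; have t0 : 0 < t by rewrite mulr_gt0.
have t1 : 0 < 1 + t by rewrite addr_gt0.
pose v := (1 + t)%:C * w.
have tC : (1 + t)%:C != 0 by rewrite fmorph_eq0 gt_eqF.
have v0 : v != 0 by rewrite mulf_neq0.
have [Rv Iv] : complex.Re v = (1 + t) * complex.Re w /\ complex.Im v = (1 + t) * complex.Im w.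
  by rewrite /v; case: (w) => x y /=; split; ring.
exists (- v^-1); last first.
  have -> : - w^-1 - - v^-1 = - ((t / (1 + t))%:C * w^-1).
    rewrite /v (_ : t / (1 + t) = 1 - (1 + t)^-1); last by field; lra.
    by rewrite rmorphB fmorphV rmorph1 invfM; ring.
  rewrite cabsN cabsM cabs_real gtr0_norm ?divr_gt0 // cabsV ltr_pdivrMr //.
  by rewrite ltr_pdivrMr // ltr_pMr // ltrDl.
have hv : not_nneg_real v.
  by case: hw => h; [left; rewrite Iv (mulf_neq0 (lt0r_neq0 t1) h)|right; rewrite Rv pmulr_rlt0].
have d0 : 0 < t / (1 + t) by rewrite divr_gt0.
have [m [eta [eta0 h]]] := small_representable hv d0.
have cv : 0 < cabs v by rewrite cabs_gt0.
have [N hN] := (complex_cvgP _ _).1 aw _ (mulr_gt0 eta0 cv).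
pose L := maxn m N.
have sL : cabs (psum a w L.+1) < eta * cabs v.
  by have := hN L.+1; rewrite subr0; apply; rewrite leqW // leq_maxr.
(* Division by v lets the correction start in degree 1, so the constant coefficient stays 1. *)
have [||q q01 qL] := h (- (psum a w L.+1 / v)).
- by rewrite cabsN cabsM cabsV ltr_pdivrMr.
- move=> iv; have iw : complex.Im w = 0.
    by move/eqP: iv; rewrite Iv mulf_eq0 gt_eqF //= => /eqP.
  rewrite psum_real // (_ : v = ((1 + t) * complex.Re w)%:C) -?fmorphV -?rmorphM -?rmorphN //.
  by apply/eqP; rewrite eq_complex /= Rv iv !eqxx.
pose b n := a n / (1 + t) ^+ n + (if n is k.+1 then q k else 0).
have b0 : b 0%N = 1 by rewrite /b expr0 divr1 a0 addr0.
have b01 n : 0 <= b n <= 1.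
  case: n => [|n]; first by rewrite b0 ler01 lexx.
  have /andP[an0 an1] := a01 n.+1; have /andP[q0 q1] := q01 n.
  have p0 : 0 < (1 + t) ^+ n.+1 by rewrite exprn_gt0.
  rewrite /b addr_ge0 ?divr_ge0 ?(ltW p0) //=.
  have e1 : (1 + t)^-1 + t / (1 + t) = 1 by field; lra.
  rewrite -[leRHS]e1 lerD // ler_pdivrMr // (le_trans an1) // exprS mulKf ?gt_eqF //.
  by rewrite exprn_ege1 // lerDl ltW.
have bv : psum b v L.+1 = 0.
  transitivity (psum a w L.+1 + v * psum q v L); last first.
    by rewrite qL ?leq_maxl // mulrN mulrC divfK // subrr.
  rewrite /psum big_nat_recl // [X in _ = X + _]big_nat_recl // b0 a0 !expr0.
  rewrite -[RHS]addrA; congr (_ + _); rewrite mulr_sumr -big_split /=.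
  apply: eq_bigr => i _; rewrite /b rmorphD mulrDl; congr (_ + _).
    rewrite rmorphM fmorphV rmorphXn /= /v exprMn mulrA mulfVK //.
    by rewrite expf_neq0.
  by rewrite exprS mulrCA.
apply: (@root_mem_Phi _ L (fun i => b (L - i)%N)).
- by move=> i _; apply: b01.
- by rewrite subnn.
by rewrite opprK psum_rev // bv mulr0.
Qed.

(** * Equality of the four sets *)

Lemma target_sub_Phi (R : realType) : @target R `<=` Phi E1.
Proof. by move=> z [/unit_disk_Phi //|[w Gw <-]]; apply: calG_Phi. Qed.

Theorem theorem2p3 (R : realType) :
  [/\ Phi E1 = Phi_hat E1 :> set R[i],
      Phi_hat E1 = Phi_star E1 :> set R[i] &
      Phi_star E1 =
        closure (@unit_disk R)
        `|` [set - z^-1 | z in @calG R `[0, 1]]].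
Proof.
have hat : Phi_hat E1 = @target R.
  rewrite eqEsubset; split; first exact: Phi_hat_sub_target.
  exact: subset_trans (@target_sub_Phi R) (@Phi_sub_Phi_hat R).
have star : Phi_star E1 = @target R.
  rewrite eqEsubset; split; first exact: Phi_star_sub_target.
  exact: subset_trans (@target_sub_Phi R) (@Phi_sub_Phi_star R).
split; [|by rewrite hat|exact: star].
rewrite hat eqEsubset; split; last exact: target_sub_Phi.
by rewrite -hat; apply: Phi_sub_Phi_hat.
Qed.
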